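(* Let $A$ be a unitary $*$-algebra of the type $F+J(A)$ over a field $F$ of characteristic zero, generating a variety with quadratic codimension growth. For the multiplicities $m_{((1)_{0^-},(1)_{1^+})}$, $m_{((1)_{1^+},(1)_{1^-})}$ and $m_{((1)_{0^-},(1)_{1^-})}$ in the proper cocharacters of $A$, we have: (1) $m_{((1)_{0^-},(1)_{1^+})}=2$ if and only if $\mathcal{G}_{2,\gamma}^{gri} \oplus W_{\eta_1}^{gri} \in \mathrm{var}^*(A)$. (2) $m_{((1)_{1^+},(1)_{1^-})}=2$ if and only if $\mathcal{G}_{2,\gamma}^{gr} \oplus W_{\eta_2}^{gr} \in \mathrm{var}^*(A)$. (3) $m_{((1)_{0^-},(1)_{1^-})}=2$ if and only if $\mathcal{G}_{2,\tau}^{gri} \oplus W_{\eta_3}^{gri} \in \mathrm{var}^*(A)$.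
   Context: Throughout, $F$ is a field of characteristic zero and algebras are associative over $F$. A superalgebra is an algebra $A=A_0\oplus A_1$ with $A_iA_j\subseteq A_{i+j}$ (indices mod 2); we also write $A=(A_0,A_1)$. A superinvolution on $A$ is a linear map $*:A\to A$ with $A_i^*\subseteq A_i$, $(a^* )^*=a$ and $(ab)^*=(-1)^{|a||b|}b^*a^*$ for all homogeneous $a,b$. A $*$-algebra is a superalgebra with a superinvolution; it is unitary if it has a unit. Direct sums carry the componentwise grading and superinvolution. Put $A_i^{+}=\{a\in A_i: a^*=a\}$, $A_i^-=\{a\in A_i:a^*=-a\}$. $J(A)$ is the Jacobson radical; ''of the type $F+J(A)$'' means $A=F1_A+J(A)$. Let $\mathcal F$ be the free associative algebra on the disjoint sets $X_i^\varepsilon=\{x_{1,i}^\varepsilon,x_{2,i}^\varepsilon,\dots\}$, $i\in\{0,1\}$, $\varepsilon\in\{+,-\}$, where variables in $X_i^\varepsilon$ have degree $i$ and are symmetric ($\varepsilon=+$) or skew ($\varepsilon=-$). $\mathrm{Id}^*(A)$ is the set of $f\in\mathcal F$ (the $*$-identities) vanishing under all substitutions sending each $x_{j,i}^\varepsilon$ into $A_i^\varepsilon$, and $\mathrm{var}^*(A)$ is the class of all $*$-algebras $B$ with $\mathrm{Id}^*(A)\subseteq\mathrm{Id}^*(B)$. $P_n^*$ is the span of all $w_{\sigma(1)}\cdots w_{\sigma(n)}$, $\sigma\in S_n$, $w_j\in\{x_{j,0}^+,x_{j,0}^-,x_{j,1}^+,x_{j,1}^-\}$, and $c_n^*(A)=\dim_F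 P_n^*/(P_n^*\cap \mathrm{Id}^*(A))$. Quadratic codimension growth means $\lim_{n\to\infty}c_n^*(A)/(\alpha n^2)=1$ for some $\alpha\ne0$. A multilinear polynomial is proper if it is a linear combination of products of variables from $X_0^-$, then variables from $X_1^+$, then variables from $X_1^-$, followed by (left-normed) commutators of length at least 2 in arbitrary variables. For $n=n_1+\cdots+n_4$, $\Gamma_{n_1,\dots,n_4}$ is the space of proper multilinear polynomials of degree $n$ in which the first $n_1$ variables are symmetric of degree 0, the next $n_2$ skew of degree 0, the next $n_3$ symmetric of degree 1, the last $n_4$ skew of degree 1. The group $S_{n_1}\times\cdots\times S_{n_4}$ acts by permuting variables of the same type, and the character of $\Gamma_{n_1,\dots,n_4}(A)=\Gamma_{n_1,\dots,n_4}/(\Gamma_{n_1,\dots,n_4}\cap\mathrm{Id}^*(A))$ decomposes as $\pi_{n_1,\dots,n_4}(A)=\sum m_{\lambda_1,\dots,\lambda_4}\,\chi_{\lambda_1}\otimes\cdots\otimes\chi_{\lambda_4}$, summed over $\lambda_i\vdash n_i$ (the proper cocharacter of $A$). A multipartition is written $((\lambda_1)_{0^+},(\lambda_2)_{0^-},(\lambda_3)_{1^+},(\lambda_4)_{1^-})$ with empty partitions omitted; e.g. $m_{((1)_{0^-},(1)_{1^+})}$ is the multiplicity for $(n_1,\dots,n_4)=(0,1,1,0)$ and $\lambda_2=\lambda_3=(1)$. Algebras. $\mathcal G_2=\langle 1,e_1,e_2\mid e_ie_j=-e_je_i,\ i,j=1,2\rangle$ (basis $1,e_1,e_2,e_1e_2$).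 Gradings: $\mathcal G_2^{gr}=(F1+Fe_1e_2,\,Fe_1+Fe_2)$; $\mathcal G_2^{gri}=(F1+Fe_1,\,Fe_2+Fe_1e_2)$. Superinvolutions determined by $\tau(e_i)=-e_i$, $\gamma(e_i)=(-1)^ie_i$ ($i=1,2$). $\mathcal G_{2,\gamma}^{gr}$ is $\mathcal G_2^{gr}$ with $\gamma$; $\mathcal G_{2,\gamma}^{gri},\mathcal G_{2,\tau}^{gri}$ are $\mathcal G_2^{gri}$ with $\gamma$, resp. $\tau$. $W=\{a(e_{11}+e_{22}+e_{33}+e_{44})+b(e_{12}+e_{34})+c(e_{13}+e_{24})+de_{14}:a,b,c,d\in F\}$ ($e_{ij}$ matrix units). Maps: $\eta_1:(a,b,c,d)\mapsto(a,-b,c,-d)$, $\eta_2:(a,b,c,d)\mapsto(a,-b,c,d)$, $\eta_3:(a,b,c,d)\mapsto(a,-b,-c,d)$. $W_{\eta_2}^{gr}$: grading $(F(e_{11}+\cdots+e_{44})+Fe_{14},\,F(e_{12}+e_{34})+F(e_{13}+e_{24}))$, superinvolution $\eta_2$. $W_{\eta_1}^{gri}$, $W_{\eta_3}^{gri}$: grading $(F(e_{11}+\cdots+e_{44})+F(e_{12}+e_{34}),\,F(e_{13}+e_{24})+Fe_{14})$, superinvolution $\eta_1$, resp. $\eta_3$. *)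

(* Defs.v *)
From HB Require Import structures.
From mathcomp Require Import all_boot all_order all_algebra all_fingroup.
From mathcomp Require Import ring.
From mathcomp Require Import boolp classical_sets reals topology normedtype.
From mathcomp Require Import sequences.
(* The notations of monalg are incompatible with those of topology. *)
From mathcomp.multinomials Require Import -(notations) monalg.

Set Implicit Arguments.
Unset Strict Implicit.
Unset Printing Implicit Defensive.

Import Order.TTheory GRing.Theory Num.Theory.
Import numFieldNormedType.Exports.

Local Open Scope classical_set_scope.
Local Open Scope ring_scope.

Section LinearAlgebra.
Variables (F : fieldType) (V : lmodType F).
Implicit Types (P U S : set V).

Definition subspace U : Prop :=
  U 0 /\ forall (c : F) (u v : V), U u -> U v -> U (c *: u + v).

Definition lspan S : set V :=
  [set p | exists (k : nat) (a : 'I_k -> F) (v : 'I_k -> V),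
    (forall i, S (v i)) /\ p = \sum_i a i *: v i].

(* For subspaces P and U of V: the classes of b_0, ..., b_(k-1) form a basis
   of the quotient space P / (P `&` U). *)
Definition basis_mod P U (k : nat) (b : 'I_k -> V) : Prop :=
  [/\ forall i, P (b i),
      forall a : 'I_k -> F, U (\sum_i a i *: b i) -> forall i, a i = 0
    & forall p, P p -> exists a : 'I_k -> F, U (p - \sum_i a i *: b i)].

(* dim P / (P `&` U); the default value 0 is only used when the quotient is
   infinite dimensional. *)
Definition qdim P U : nat :=
  xget 0%N [set k | exists b : 'I_k -> V, basis_mod P U b].

(* Trace of the endomorphism of P / (P `&` U) induced by f. *)
Definition qtrace P U (f : V -> V) : F :=
  xget 0 [set t | exists (k : nat) (b : 'I_k -> V) (M : 'M[F]_k),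
    [/\ basis_mod P U b,
        forall i, U (f (b i) - \sum_j M i j *: b j)
      & t = \tr M]].

End LinearAlgebra.

Section Jacobson.
Variables (F : fieldType) (A : algType F).

Definition left_ideal (I : set A) : Prop :=
  [/\ I 0, forall x y, I x -> I y -> I (x + y) & forall a x, I x -> I (a * x)].

Definition maximal_left_ideal (I : set A) : Prop :=
  [/\ left_ideal I, I != [set: A]
    & forall K : set A, left_ideal K -> I `<=` K -> K = I \/ K = [set: A]].

Definition jacobson_radical : set A := \bigcap_(I in maximal_left_ideal) I.

Definition type_F_plus_J : Prop :=
  [set: A] = [set a | exists (c : F) (x : A),
    jacobson_radical x /\ a = c%:A + x].

End Jacobson.

(* Degrees are booleans, added with (+): false is 0 and true is 1. *)
Definition superalgebra (F : fieldType) (A : algType F) (gr : bool -> set A) :=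
  [/\ forall i, subspace (gr i),
      forall i j a b, gr i a -> gr j b -> gr (i (+) j) (a * b),
      forall a, exists a0 a1, [/\ gr false a0, gr true a1 & a = a0 + a1]
    & forall a, gr false a -> gr true a -> a = 0].

Definition superinvolution (F : fieldType) (A : algType F)
    (gr : bool -> set A) (st : A -> A) :=
  [/\ linear st,
      forall i a, gr i a -> gr i (st a),
      involutive st
    & forall i j a b, gr i a -> gr j b ->
        st (a * b) = (-1) ^+ (i && j) * (st b * st a)].

(* Unitary *-algebras: an algType has a unit, distinct from 0. *)
Record starAlgebra (F : fieldType) := StarAlgebra {
  carrier :> algType F;
  grade : bool -> set carrier;
  star : carrier -> carrier;
  grade_superalgebra : superalgebra grade;
  star_superinvolution : superinvolution grade star }.

(* A_i^+ for s = false and A_i^- for s = true. *)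
Definition signed_part (F : fieldType) (A : starAlgebra F) (i s : bool) :
    set A :=
  [set a | grade i a /\ star a = (-1) ^+ s * a].

Section DirectSum.
Variables (F : fieldType) (A B : starAlgebra F).

Definition dsum_grade (i : bool) : set (A * B)%type :=
  [set u | grade i u.1 /\ grade i u.2].

Definition dsum_star (u : A * B) : (A * B)%type := (star u.1, star u.2).

Lemma dsum_superalgebra : superalgebra dsum_grade.
Proof.
have [A1 A2 A3 A4] := grade_superalgebra A.
have [B1 B2 B3 B4] := grade_superalgebra B.
split.
- move=> i; split; first by split; [case: (A1 i) | case: (B1 i)].
  by move=> c u v [uA uB] [vA vB]; split; [apply: (A1 i).2|apply: (B1 i).2].
- by move=> i j a b [? ?] [? ?]; split; [apply: A2 | apply: B2].
- move=> [a b]; have [a0 [a1 [a0P a1P ->]]] := A3 a.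
  have [b0 [b1 [b0P b1P ->]]] := B3 b.
  by exists (a0, b0), (a1, b1).
by move=> [a b] [/= a0 b0] [/= a1 b1]; rewrite (A4 a) // (B4 b).
Qed.

Lemma dsum_superinvolution : superinvolution dsum_grade dsum_star.
Proof.
have [A1 A2 A3 A4] := star_superinvolution A.
have [B1 B2 B3 B4] := star_superinvolution B.
split.
- by move=> c u v; rewrite /dsum_star /= A1 B1.
- by move=> i u [uA uB]; split; [apply: A2 | apply: B2].
- by move=> [a b]; rewrite /dsum_star /= A3 B3.
move=> i j a b [aA aB] [bA bB]; rewrite /dsum_star /= (A4 i j) ?(B4 i j) //.
by case: (i && j); rewrite ?expr1 ?expr0 ?mulN1r ?mul1r.
Qed.

Definition dsum : starAlgebra F :=
  StarAlgebra dsum_superalgebra dsum_superinvolution.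

End DirectSum.

Section FreeAlgebra.
Variable F : fieldType.

(* ((i, s), j) is the variable with index j of X_i^+ (s = false) or
   X_i^- (s = true). *)
Definition variable : Type := ((bool * bool) * nat)%type.
HB.instance Definition _ := Choice.on variable.

Definition free_algebra : lalgType F := malg (fmonom variable) F.

Definition var (x : variable) : free_algebra :=
  mkmalgU (fmu x) 1.

Definition eval (B : lalgType F) (phi : variable -> B) (f : free_algebra) : B :=
  mmap (GRing.in_alg B)
    (fun m : fmonom variable => \prod_(x <- fmonom_val m) phi x) f.

Definition Id (A : starAlgebra F) : set free_algebra :=
  [set f | forall phi : variable -> A,
    (forall i s j, signed_part i s (phi ((i, s), j))) -> eval phi f = 0].

Definition in_variety (A B : starAlgebra F) : Prop := Id A `<=` Id B.

Definition P_space (n : nat) : set free_algebra :=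
  lspan [set p | exists (sigma : 'S_n) (t : 'I_n -> bool * bool),
    p = \prod_(j < n) var (t (sigma j), val (sigma j))].

Definition codim (A : starAlgebra F) (n : nat) : nat := qdim (P_space n) (Id A).

Definition quadratic_growth (R : realType) (A : starAlgebra F) : Prop :=
  exists2 alpha : R, alpha != 0 &
    (fun n : nat => (codim A n)%:R / (alpha * n%:R ^+ 2)) @ \oo --> (1 : R).

Definition lcommutator (c : seq variable) : free_algebra :=
  if c is x :: s then foldl (fun p y => p * var y - var y * p) (var x) s else 1.

Definition proper : set free_algebra :=
  lspan [set p | exists (s1 s2 s3 : seq nat) (cs : seq (seq variable)),
    all (fun c => 2 <= size c)%N cs /\
    p = \prod_(j <- s1) var ((false, true), j)
      * \prod_(j <- s2) var ((true, false), j)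
      * \prod_(j <- s3) var ((true, true), j)
      * \prod_(c <- cs) lcommutator c].

Definition multilinear (xs : seq variable) : set free_algebra :=
  lspan [set p | exists2 s, perm_eq s xs & p = \prod_(x <- s) var x].

Section ProperCocharacter.
Variables n1 n2 n3 n4 : nat.

Definition Gamma_vars : seq variable :=
  [seq ((false, false), j) | j <- iota 0 n1] ++
  [seq ((false, true), j) | j <- iota n1 n2] ++
  [seq ((true, false), j) | j <- iota (n1 + n2)%N n3] ++
  [seq ((true, true), j) | j <- iota (n1 + n2 + n3)%N n4].

Definition Gamma : set free_algebra := multilinear Gamma_vars `&` proper.

End ProperCocharacter.

(* The map on nat sending off + i to off + s i for i < n, and fixing all other
   integers. *)
Definition shift_perm (off n : nat) (s : 'S_n) (j : nat) : nat :=
  if (off <= j)%N then oapp (fun i : 'I_n => (off + s i)%N) j (insub (j - off)%N)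
  else j.

Definition rename_var n1 n2 n3 n4
    (s1 : 'S_n1) (s2 : 'S_n2) (s3 : 'S_n3) (s4 : 'S_n4) (x : variable) :
    variable :=
  (x.1, match x.1 with
        | (false, false) => shift_perm 0 s1 x.2
        | (false, true) => shift_perm n1 s2 x.2
        | (true, false) => shift_perm (n1 + n2)%N s3 x.2
        | (true, true) => shift_perm (n1 + n2 + n3)%N s4 x.2
        end).

Definition Gamma_char (A : starAlgebra F) n1 n2 n3 n4
    (s1 : 'S_n1) (s2 : 'S_n2) (s3 : 'S_n3) (s4 : 'S_n4) : F :=
  qtrace (Gamma n1 n2 n3 n4) (Id A)
    (eval (fun x => var (rename_var s1 s2 s3 s4 x))).

End FreeAlgebra.

(* A partition of n, padded with zeros to length n. *)
Definition is_partn n (t : n.-tuple 'I_n.+1) : bool :=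
  sorted geq [seq val i | i <- t] && (sumn [seq val i | i <- t] == n).
Definition partn n := {t : n.-tuple 'I_n.+1 | is_partn t}.
HB.instance Definition _ n := Finite.on (partn n).

Definition part_empty : partn 0 := exist _ [tuple] isT.
Definition part_one : partn 1 := exist _ [tuple ord_max] isT.

Section Specht.
Variables (F : fieldType) (n : nat) (l : partn n).

Definition parts : seq nat := [seq val i | i <- val l].

(* The Young tableau of shape l whose entries increase along the rows and from
   one row to the next: row and column of an entry. *)
Definition tab_row (i : 'I_n) : nat := reshape_index parts i.
Definition tab_col (i : 'I_n) : nat := reshape_offset parts i.

Definition row_stab : {set 'S_n} :=
  [set s : 'S_n | [forall i, tab_row (s i) == tab_row i]].
Definition col_stab : {set 'S_n} :=
  [set s : 'S_n | [forall i, tab_col (s i) == tab_col i]].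

Definition group_algebra : lmodType F := {ffun 'S_n -> F^o}.

Definition convol (a b : group_algebra) : group_algebra :=
  [ffun s => \sum_(t : 'S_n) a t * b (t^-1 * s)%g].

Definition young_symmetrizer : group_algebra :=
  [ffun s => \sum_(r in row_stab) \sum_(c in col_stab)
               (-1) ^+ odd_perm c * (s == r * c)%g%:R].

Definition specht : set group_algebra :=
  [set x | exists a, x = convol a young_symmetrizer].

Definition left_mult (s : 'S_n) (x : group_algebra) : group_algebra :=
  [ffun t => x (s^-1 * t)%g].

Definition chi (s : 'S_n) : F := qtrace specht [set 0] (left_mult s).

End Specht.

Definition proper_cocharacter (F : fieldType) (A : starAlgebra F)
    (n1 n2 n3 n4 : nat) :
    {ffun partn n1 * partn n2 * partn n3 * partn n4 -> nat} :=
  xget [ffun=> 0%N]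
    [set m | forall (s1 : 'S_n1) (s2 : 'S_n2) (s3 : 'S_n3) (s4 : 'S_n4),
      Gamma_char A s1 s2 s3 s4 =
      \sum_(l : partn n1 * partn n2 * partn n3 * partn n4)
        (m l)%:R * (chi F l.1.1.1 s1 * chi F l.1.1.2 s2
                    * chi F l.1.2 s3 * chi F l.2 s4)].

(* m_((l1)_0+, (l2)_0-, (l3)_1+, (l4)_1-). *)
Definition multiplicity (F : fieldType) (A : starAlgebra F) n1 n2 n3 n4
    (l1 : partn n1) (l2 : partn n2) (l3 : partn n3) (l4 : partn n4) : nat :=
  proper_cocharacter A n1 n2 n3 n4 (l1, l2, l3, l4).

Section G2.
Variable F : fieldType.

(* The coordinates refer to the basis 1, e_1, e_2, e_1 e_2. *)
Definition G2 : Type := 'rV[F]_4.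
HB.instance Definition _ := GRing.Lmodule.on G2.

Definition G2elt (a b c d : F) : G2 := \row_(i < 4) [:: a; b; c; d]`_i.

Definition G2mul (u v : G2) : G2 :=
  G2elt (u 0 0 * v 0 0)
        (u 0 0 * v 0 1 + u 0 1 * v 0 0)
        (u 0 0 * v 0 2 + u 0 2 * v 0 0)
        (u 0 0 * v 0 3 + u 0 3 * v 0 0 + (u 0 1 * v 0 2 - u 0 2 * v 0 1)).

Lemma G2E a b c d : (G2elt a b c d 0 0 = a) * (G2elt a b c d 0 1 = b) *
  (G2elt a b c d 0 2 = c) * (G2elt a b c d 0 3 = d).
Proof. by rewrite /G2elt !mxE. Qed.

Lemma G2P (u v : G2) : u 0 0 = v 0 0 -> u 0 1 = v 0 1 -> u 0 2 = v 0 2 ->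
  u 0 3 = v 0 3 -> u = v.
Proof.
move=> h0 h1 h2 h3; apply/rowP => -[[|[|[|[|//]]]] i].
- by rewrite (_ : Ordinal i = 0) //; apply: val_inj.
- by rewrite (_ : Ordinal i = 1) //; apply: val_inj.
- by rewrite (_ : Ordinal i = 2) //; apply: val_inj.
- by rewrite (_ : Ordinal i = 3) //; apply: val_inj.
Qed.

Fact G2mulA : associative G2mul.
Proof. by move=> u v w; apply: G2P; rewrite /G2mul !G2E; ring. Qed.
Fact G2mul1 : left_id (G2elt 1 0 0 0) G2mul.
Proof. by move=> u; apply: G2P; rewrite /G2mul !G2E; ring. Qed.
Fact G2mulr1 : right_id (G2elt 1 0 0 0) G2mul.
Proof. by move=> u; apply: G2P; rewrite /G2mul !G2E; ring. Qed.
Fact G2mulDl : left_distributive G2mul +%R.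
Proof. by move=> u v w; apply: G2P; rewrite /G2mul !(G2E, mxE); ring. Qed.
Fact G2mulDr : right_distributive G2mul +%R.
Proof. by move=> u v w; apply: G2P; rewrite /G2mul !(G2E, mxE); ring. Qed.
Fact G2oner_neq0 : G2elt 1 0 0 0 != 0.
Proof.
apply/eqP => /rowP/(_ 0); rewrite G2E mxE => /eqP; exact/negP/oner_neq0.
Qed.
HB.instance Definition _ := GRing.Zmodule_isNzRing.Build G2
  G2mulA G2mul1 G2mulr1 G2mulDl G2mulDr G2oner_neq0.

Fact G2scaleAl (c : F) (u v : G2) : c *: (u * v) = (c *: u) * v.
Proof.
by apply: G2P; rewrite [u * v]/(G2mul u v) [_ * v]/(G2mul _ v) /G2mul;
  rewrite !(G2E, mxE); ring.
Qed.
HB.instance Definition _ := GRing.Lmodule_isLalgebra.Build F G2 G2scaleAl.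
Fact G2scaleAr (c : F) (u v : G2) : c *: (u * v) = u * (c *: v).
Proof.
by apply: G2P; rewrite [u * v]/(G2mul u v) [u * _]/(G2mul u _) /G2mul;
  rewrite !(G2E, mxE); ring.
Qed.
HB.instance Definition _ := GRing.Lalgebra_isAlgebra.Build F G2 G2scaleAr.

Lemma G2mulE a b c d a' b' c' d' :
  G2elt a b c d * G2elt a' b' c' d' =
  G2elt (a * a') (a * b' + b * a') (a * c' + c * a')
        (a * d' + d * a' + (b * c' - c * b')).
Proof. by apply: G2P; rewrite [_ * _]/(G2mul _ _) /G2mul !G2E. Qed.

Lemma G2linE k a b c d a' b' c' d' :
  k *: G2elt a b c d + G2elt a' b' c' d' =
  G2elt (k * a + a') (k * b + b') (k * c + c') (k * d + d').
Proof. by apply: G2P; rewrite !(G2E, mxE). Qed.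

Lemma G2eta (u : G2) : u = G2elt (u 0 0) (u 0 1) (u 0 2) (u 0 3).
Proof. by apply: G2P; rewrite !G2E. Qed.

Definition e1 : G2 := G2elt 0 1 0 0.
Definition e2 : G2 := G2elt 0 0 1 0.

Lemma G2_relations :
  [/\ e1 * e1 = 0, e2 * e2 = 0, e1 * e2 = - (e2 * e1)
    & forall a b c d, G2elt a b c d =
        a *: 1 + b *: e1 + c *: e2 + d *: (e1 * e2)].
Proof.
by split=> [|||a b c d]; rewrite ?G2mulE; apply: G2P; rewrite !(G2E, mxE); ring.
Qed.

Definition G2_gr (i : bool) : set G2 :=
  if i then [set u | exists b c, u = b *: e1 + c *: e2]
  else [set u | exists a d, u = a *: 1 + d *: (e1 * e2)].

Definition G2_gri (i : bool) : set G2 :=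
  if i then [set u | exists c d, u = c *: e2 + d *: (e1 * e2)]
  else [set u | exists a b, u = a *: 1 + b *: e1].

(* The last sign in each of the following maps is forced by
   (e_1 e_2)^* = (-1)^(|e_1| |e_2|) e_2^* e_1^*. *)
Definition gamma_gr (u : G2) : G2 :=
  G2elt (u 0 0) (- u 0 1) (u 0 2) (- u 0 3).
Definition gamma_gri (u : G2) : G2 :=
  G2elt (u 0 0) (- u 0 1) (u 0 2) (u 0 3).
Definition tau_gri (u : G2) : G2 :=
  G2elt (u 0 0) (- u 0 1) (- u 0 2) (- u 0 3).

Lemma G2_grE i (u : G2) : G2_gr i u <->
  if i then u 0 0 = 0 /\ u 0 3 = 0 else u 0 1 = 0 /\ u 0 2 = 0.
Proof.
have [_ _ _ decE] := G2_relations; case: i; split.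
- by move=> [b [c ->]]; rewrite !mxE /=; split; ring.
- move=> [u0 u3]; exists (u 0 1), (u 0 2).
  by rewrite {1}(G2eta u) decE u0 u3 !scale0r add0r addr0.
- by move=> [a [d ->]]; rewrite G2mulE !mxE /=; split; ring.
- move=> [u1 u2]; exists (u 0 0), (u 0 3).
  by rewrite {1}(G2eta u) decE u1 u2 !scale0r !addr0.
Qed.

Lemma G2_griE i (u : G2) : G2_gri i u <->
  if i then u 0 0 = 0 /\ u 0 1 = 0 else u 0 2 = 0 /\ u 0 3 = 0.
Proof.
have [_ _ _ decE] := G2_relations; case: i; split.
- by move=> [c [d ->]]; rewrite G2mulE !mxE /=; split; ring.
- move=> [u0 u1]; exists (u 0 2), (u 0 3).
  by rewrite {1}(G2eta u) decE u0 u1 !scale0r !add0r.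
- by move=> [a [b ->]]; rewrite !mxE /=; split; ring.
- move=> [u2 u3]; exists (u 0 0), (u 0 1).
  by rewrite {1}(G2eta u) decE u2 u3 !scale0r !addr0.
Qed.

Lemma G2mul_coord (u v : G2) : u * v =
  G2elt (u 0 0 * v 0 0) (u 0 0 * v 0 1 + u 0 1 * v 0 0)
        (u 0 0 * v 0 2 + u 0 2 * v 0 0)
        (u 0 0 * v 0 3 + u 0 3 * v 0 0 + (u 0 1 * v 0 2 - u 0 2 * v 0 1)).
Proof. by []. Qed.

Lemma G2_gr_superalgebra : superalgebra G2_gr.
Proof.
split.
- move=> i; split; first by apply/G2_grE; case: i; rewrite !mxE.
  move=> c u v /G2_grE hu /G2_grE hv; apply/G2_grE.
  by case: i hu hv => -[h1 h2] [h3 h4]; rewrite !mxE ?(h1, h2, h3, h4); split; ring.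
- move=> i j u v /G2_grE hu /G2_grE hv; apply/G2_grE; rewrite G2mul_coord.
  by case: i j hu hv => -[] [h1 h2] [h3 h4] /=; rewrite !G2E ?(h1, h2, h3, h4);
    split; ring.
- move=> u; exists (G2elt (u 0 0) 0 0 (u 0 3)), (G2elt 0 (u 0 1) (u 0 2) 0).
  split; [by apply/G2_grE; rewrite !G2E.. |].
  by apply: G2P; rewrite !(G2E, mxE); ring.
by move=> u /G2_grE[u1 u2] /G2_grE[u0 u3]; apply: G2P;
  rewrite ?u0 ?u1 ?u2 ?u3 mxE.
Qed.

Lemma G2_gri_superalgebra : superalgebra G2_gri.
Proof.
split.
- move=> i; split; first by apply/G2_griE; case: i; rewrite !mxE.
  move=> c u v /G2_griE hu /G2_griE hv; apply/G2_griE.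
  by case: i hu hv => -[h1 h2] [h3 h4]; rewrite !mxE ?(h1, h2, h3, h4); split; ring.
- move=> i j u v /G2_griE hu /G2_griE hv; apply/G2_griE; rewrite G2mul_coord.
  by case: i j hu hv => -[] [h1 h2] [h3 h4] /=; rewrite !G2E ?(h1, h2, h3, h4);
    split; ring.
- move=> u; exists (G2elt (u 0 0) (u 0 1) 0 0), (G2elt 0 0 (u 0 2) (u 0 3)).
  split; [by apply/G2_griE; rewrite !G2E.. |].
  by apply: G2P; rewrite !(G2E, mxE); ring.
by move=> u /G2_griE[u2 u3] /G2_griE[u0 u1]; apply: G2P;
  rewrite ?u0 ?u1 ?u2 ?u3 mxE.
Qed.

Lemma gamma_gr_superinvolution : superinvolution G2_gr gamma_gr.
Proof.
split; rewrite /gamma_gr.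
- by move=> c u v; apply: G2P; rewrite !(G2E, mxE); ring.
- move=> i u /G2_grE hu; apply/G2_grE.
  by case: i hu => -[h1 h2]; rewrite !G2E h1 h2 ?oppr0.
- by move=> u; apply: G2P; rewrite !G2E ?opprK.
move=> i j u v /G2_grE hu /G2_grE hv.
by case: i j hu hv => -[] [h1 h2] [h3 h4] /=;
  rewrite ?expr1 ?expr0 ?mulN1r ?mul1r !G2mul_coord; apply: G2P;
  rewrite !(G2E, mxE) ?(h1, h2, h3, h4); ring.
Qed.

Lemma gamma_gri_superinvolution : superinvolution G2_gri gamma_gri.
Proof.
split; rewrite /gamma_gri.
- by move=> c u v; apply: G2P; rewrite !(G2E, mxE); ring.
- move=> i u /G2_griE hu; apply/G2_griE.
  by case: i hu => -[h1 h2]; rewrite !G2E h1 h2 ?oppr0.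
- by move=> u; apply: G2P; rewrite !G2E ?opprK.
move=> i j u v /G2_griE hu /G2_griE hv.
by case: i j hu hv => -[] [h1 h2] [h3 h4] /=;
  rewrite ?expr1 ?expr0 ?mulN1r ?mul1r !G2mul_coord; apply: G2P;
  rewrite !(G2E, mxE) ?(h1, h2, h3, h4); ring.
Qed.

Lemma tau_gri_superinvolution : superinvolution G2_gri tau_gri.
Proof.
split; rewrite /tau_gri.
- by move=> c u v; apply: G2P; rewrite !(G2E, mxE); ring.
- move=> i u /G2_griE hu; apply/G2_griE.
  by case: i hu => -[h1 h2]; rewrite !G2E h1 h2 ?oppr0.
- by move=> u; apply: G2P; rewrite !G2E ?opprK.
move=> i j u v /G2_griE hu /G2_griE hv.
by case: i j hu hv => -[] [h1 h2] [h3 h4] /=;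
  rewrite ?expr1 ?expr0 ?mulN1r ?mul1r !G2mul_coord; apply: G2P;
  rewrite !(G2E, mxE) ?(h1, h2, h3, h4); ring.
Qed.

Definition G2_gamma_gr : starAlgebra F :=
  StarAlgebra G2_gr_superalgebra gamma_gr_superinvolution.
Definition G2_gamma_gri : starAlgebra F :=
  StarAlgebra G2_gri_superalgebra gamma_gri_superinvolution.
Definition G2_tau_gri : starAlgebra F :=
  StarAlgebra G2_gri_superalgebra tau_gri_superinvolution.

End G2.

Section W.
Variable F : fieldType.

Definition Wmx (a b c d : F) : 'M[F]_4 :=
  a *: (delta_mx 0 0 + delta_mx 1 1 + delta_mx 2 2 + delta_mx 3 3)
  + b *: (delta_mx 0 1 + delta_mx 2 3)
  + c *: (delta_mx 0 2 + delta_mx 1 3)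
  + d *: delta_mx 0 3.

Definition W_pred : {pred 'M[F]_4} :=
  fun M => M == Wmx (M 0 0) (M 0 1) (M 0 2) (M 0 3).

Lemma WmxE a b c d : (Wmx a b c d 0 0 = a) * (Wmx a b c d 0 1 = b) *
  (Wmx a b c d 0 2 = c) * (Wmx a b c d 0 3 = d).
Proof. by do !split; rewrite !mxE /=; ring. Qed.

Lemma W_predP (M : 'M[F]_4) :
  reflect (exists a b c d, M = Wmx a b c d) (M \in W_pred).
Proof.
apply: (iffP eqP) => [->|[a [b [c [d ->]]]]]; last by rewrite !WmxE.
by do 4!eexists.
Qed.

Lemma Wmx_mul a b c d a' b' c' d' : Wmx a b c d *m Wmx a' b' c' d' =
  Wmx (a * a') (a * b' + b * a') (a * c' + c * a')
      (a * d' + d * a' + (b * c' + c * b')).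
Proof.
apply/matrixP => i j; rewrite mxE !big_ord_recl big_ord0.
by case: i j => [[|[|[|[|//]]]] ?] [[|[|[|[|//]]]] ?]; rewrite !mxE /=; ring.
Qed.

Lemma Wmx_lin k a b c d a' b' c' d' : k *: Wmx a b c d + Wmx a' b' c' d' =
  Wmx (k * a + a') (k * b + b') (k * c + c') (k * d + d').
Proof.
by apply/matrixP => i j; rewrite !mxE; ring.
Qed.

Lemma Wmx1 : Wmx 1 0 0 0 = 1%:M.
Proof.
apply/matrixP => i j.
by case: i j => [[|[|[|[|//]]]] ?] [[|[|[|[|//]]]] ?]; rewrite !mxE /=; ring.
Qed.

Lemma W_subalg_closed : GRing.subalg_closed W_pred.
Proof.
split; first by apply/W_predP; exists 1, 0, 0, 0; rewrite Wmx1.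
- move=> k M N /W_predP[a [b [c [d ->]]]] /W_predP[a' [b' [c' [d' ->]]]].
  by apply/W_predP; rewrite Wmx_lin; do 4!eexists.
- move=> M N /W_predP[a [b [c [d ->]]]] /W_predP[a' [b' [c' [d' ->]]]].
  by apply/W_predP; rewrite [_ * _]Wmx_mul; do 4!eexists.
Qed.
HB.instance Definition _ := GRing.isSubalgClosed.Build F 'M[F]_4 W_pred
  (GRing.subalg_closed_semi W_subalg_closed).

Record W : predArgType := MkW { W_val : 'M[F]_4; W_valP : W_val \in W_pred }.
HB.instance Definition _ := [isSub for W_val].
HB.instance Definition _ := [Choice of W by <:].
HB.instance Definition _ := [SubChoice_isSubAlgebra of W by <:].

Fact Welt_subproof a b c d : Wmx a b c d \in W_pred.
Proof. by apply/W_predP; exists a, b, c, d. Qed.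
Definition Welt a b c d : W := MkW (Welt_subproof a b c d).

Lemma W_ind (P : W -> Prop) :
  (forall a b c d, P (Welt a b c d)) -> forall u, P u.
Proof.
move=> hP u; have /W_predP[a [b [c [d eM]]]] := W_valP u.
by have -> : u = Welt a b c d by apply: val_inj.
Qed.

Lemma Welt_mul a b c d a' b' c' d' : Welt a b c d * Welt a' b' c' d' =
  Welt (a * a') (a * b' + b * a') (a * c' + c * a')
       (a * d' + d * a' + (b * c' + c * b')).
Proof. by apply: val_inj; rewrite rmorphM; apply: Wmx_mul. Qed.

Lemma Welt_lin k a b c d a' b' c' d' :
  k *: Welt a b c d + Welt a' b' c' d' =
  Welt (k * a + a') (k * b + b') (k * c + c') (k * d + d').
Proof. by apply: val_inj; rewrite linearP; apply: Wmx_lin. Qed.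

Lemma Welt_inj a b c d a' b' c' d' : Welt a b c d = Welt a' b' c' d' ->
  [/\ a = a', b = b', c = c' & d = d'].
Proof.
move=> eW; have eM : Wmx a b c d = Wmx a' b' c' d' by case: eW.
by have := WmxE a b c d; rewrite eM !WmxE => -[[[-> ->] ->] ->].
Qed.

Lemma Welt0 : Welt 0 0 0 0 = 0.
Proof. by apply: val_inj; rewrite /= /Wmx !scale0r !addr0. Qed.

Definition W_map (f : F -> F -> F -> F -> W) (u : W) : W :=
  f (W_val u 0 0) (W_val u 0 1) (W_val u 0 2) (W_val u 0 3).

Lemma W_mapE f a b c d : W_map f (Welt a b c d) = f a b c d.
Proof. by rewrite /W_map !WmxE. Qed.

Definition eta1 : W -> W := W_map (fun a b c d => Welt a (- b) c (- d)).
Definition eta2 : W -> W := W_map (fun a b c d => Welt a (- b) c d).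
Definition eta3 : W -> W := W_map (fun a b c d => Welt a (- b) (- c) d).

Definition W_gr (i : bool) : set W :=
  if i then [set u | exists b c, u = Welt 0 b c 0]
  else [set u | exists a d, u = Welt a 0 0 d].

Definition W_gri (i : bool) : set W :=
  if i then [set u | exists c d, u = Welt 0 0 c d]
  else [set u | exists a b, u = Welt a b 0 0].

Lemma W_gr_superalgebra : superalgebra W_gr.
Proof.
split.
- case; (split; first by exists 0, 0; rewrite Welt0);
    move=> k _ _ [x [y ->]] [x' [y' ->]]; rewrite Welt_lin !(mulr0, addr0);
    by do 2!eexists.
- by move=> [] [] _ _ [x [y ->]] [x' [y' ->]]; rewrite Welt_mul
    !(mulr0, mul0r, addr0, add0r); do 2!eexists.
- elim/W_ind=> a b c d; exists (Welt a 0 0 d), (Welt 0 b c 0).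
  split; [by do 2!eexists.. |].
  by rewrite -[Welt a 0 0 d]scale1r Welt_lin !(mul1r, addr0, add0r).
by move=> _ [a [d ->]] [b [c /Welt_inj[-> _ _ ->]]]; rewrite Welt0.
Qed.

Lemma W_gri_superalgebra : superalgebra W_gri.
Proof.
split.
- case; (split; first by exists 0, 0; rewrite Welt0);
    move=> k _ _ [x [y ->]] [x' [y' ->]]; rewrite Welt_lin !(mulr0, addr0);
    by do 2!eexists.
- by move=> [] [] _ _ [x [y ->]] [x' [y' ->]]; rewrite Welt_mul
    !(mulr0, mul0r, addr0, add0r); do 2!eexists.
- elim/W_ind=> a b c d; exists (Welt a b 0 0), (Welt 0 0 c d).
  split; [by do 2!eexists.. |].
  by rewrite -[Welt a b 0 0]scale1r Welt_lin !(mul1r, addr0, add0r).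
by move=> _ [a [b ->]] [c [d /Welt_inj[-> -> _ _]]]; rewrite Welt0.
Qed.

Lemma Welt_sign (s : bool) a b c d :
  (-1) ^+ s * Welt a b c d =
  Welt ((-1) ^+ s * a) ((-1) ^+ s * b) ((-1) ^+ s * c) ((-1) ^+ s * d).
Proof.
rewrite -[in LHS](rmorph1 (GRing.in_alg W)) -rmorphN -rmorphXn /= mulr_algl.
by rewrite -[LHS]addr0 -Welt0 Welt_lin !addr0.
Qed.

Lemma eta2_superinvolution : superinvolution W_gr eta2.
Proof.
split.
- move=> k; elim/W_ind=> a b c d; elim/W_ind=> a' b' c' d'.
  by rewrite /eta2 Welt_lin !W_mapE Welt_lin; congr Welt; ring.
- by move=> [] _ [x [y ->]]; rewrite /eta2 W_mapE ?oppr0; do 2!eexists.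
- by elim/W_ind=> a b c d; rewrite /eta2 !W_mapE opprK.
by move=> [] [] _ _ [x [y ->]] [x' [y' ->]];
  rewrite /eta2 Welt_mul !W_mapE Welt_mul Welt_sign; congr Welt; ring.
Qed.

Lemma eta1_superinvolution : superinvolution W_gri eta1.
Proof.
split.
- move=> k; elim/W_ind=> a b c d; elim/W_ind=> a' b' c' d'.
  by rewrite /eta1 Welt_lin !W_mapE Welt_lin; congr Welt; ring.
- by move=> [] _ [x [y ->]]; rewrite /eta1 W_mapE ?oppr0; do 2!eexists.
- by elim/W_ind=> a b c d; rewrite /eta1 !W_mapE !opprK.
by move=> [] [] _ _ [x [y ->]] [x' [y' ->]];
  rewrite /eta1 Welt_mul !W_mapE Welt_mul Welt_sign; congr Welt; ring.
Qed.

Lemma eta3_superinvolution : superinvolution W_gri eta3.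
Proof.
split.
- move=> k; elim/W_ind=> a b c d; elim/W_ind=> a' b' c' d'.
  by rewrite /eta3 Welt_lin !W_mapE Welt_lin; congr Welt; ring.
- by move=> [] _ [x [y ->]]; rewrite /eta3 W_mapE ?oppr0; do 2!eexists.
- by elim/W_ind=> a b c d; rewrite /eta3 !W_mapE !opprK.
by move=> [] [] _ _ [x [y ->]] [x' [y' ->]];
  rewrite /eta3 Welt_mul !W_mapE Welt_mul Welt_sign; congr Welt; ring.
Qed.

Definition W_eta1_gri : starAlgebra F :=
  StarAlgebra W_gri_superalgebra eta1_superinvolution.
Definition W_eta2_gr : starAlgebra F :=
  StarAlgebra W_gr_superalgebra eta2_superinvolution.
Definition W_eta3_gri : starAlgebra F :=
  StarAlgebra W_gri_superalgebra eta3_superinvolution.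

End W.

(* Main.v *)
(* In each part let [t], [t'] be the two types of variables involved. Since the
   symmetric groups are trivial, the multiplicity is the dimension of the span
   of [xy] and [yx] modulo [Id A], so that it is 2 if and only if no nontrivial
   [a xy + b yx] is an identity of [A]. The two algebras of the direct sum are
   spanned by [1, u, v, uv] with [u] and [v] of types [t] and [t'],
   [u^2 = v^2 = 0] and [vu = -uv], resp. [vu = uv]; together they satisfy no
   such identity. Conversely, if [A] satisfies none, an evaluation
   [x |-> a + p u + q v + r uv] of an identity of [A] in one of these algebras
   is imitated in [A], over all [s] in [F], by
   [x |-> a + p y s^2 + q z s^3 + r (yz +- zy)/2 s^5]. The coefficients of
   [1, s^2, s^3, s^5] vanish for all [y] and [z], whence so do the coefficients
   of [1, u, v, uv]. *)

Require Import Defs.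
From mathcomp Require Import all_boot all_order all_algebra all_fingroup.
From mathcomp Require Import boolp classical_sets reals topology normedtype.
From mathcomp.multinomials Require Import -(notations) monalg.
From mathcomp Require Import ring.

Set Implicit Arguments.
Unset Strict Implicit.
Unset Printing Implicit Defensive.

(* [Defs] comes last because [topology] also has a [subspace]. *)
Import GRing.Theory Defs.
Local Open Scope ring_scope.

(** * Dimension and trace on quotients by a subspace *)

Lemma subspace_sum (F : fieldType) (V : lmodType F) (U : set V) :
  subspace U -> forall (I : Type) (r : seq I) (a : I -> F) (v : I -> V),
  (forall i, U (v i)) -> U (\sum_(i <- r) a i *: v i).
Proof.
move=> [U0 UL] I r a v Uv; elim: r => [|i r IHr]; first by rewrite big_nil.
by rewrite big_cons; apply: UL.
Qed.

Lemma subspaceB (F : fieldType) (V : lmodType F) (U : set V) :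
  subspace U -> forall x y, U x -> U y -> U (x - y).
Proof. by move=> [_ UL] x y Ux Uy; rewrite addrC -scaleN1r; apply: UL. Qed.

Lemma subspaceD (F : fieldType) (V : lmodType F) (U : set V) :
  subspace U -> forall x y, U x -> U y -> U (x + y).
Proof. by move=> [_ UL] x y Ux Uy; rewrite -[x]scale1r; apply: UL. Qed.

Lemma subspaceZ (F : fieldType) (V : lmodType F) (U : set V) :
  subspace U -> forall c x, U x -> U (c *: x).
Proof. by move=> [U0 UL] c x Ux; rewrite -[c *: x]addr0; apply: UL. Qed.

(** Expressing each family through the other modulo [U] gives matrices [MM] and [NN]. Freeness of
    [b] forces their product to be the identity of size [k], whose rank cannot exceed the inner size
    [k']. *)
Lemma basis_mod_leq (F : fieldType) (V : lmodType F) (P U : set V) k k'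
    (b : 'I_k -> V) (b' : 'I_k' -> V) :
  subspace U -> basis_mod P U b -> basis_mod P U b' -> (k <= k')%N.
Proof.
move=> Usub [bP bfree bgen] [b'P _ b'gen].
have [M MP] := choice (fun i => b'gen _ (bP i)).
have [N NP] := choice (fun i => bgen _ (b'P i)).
pose MM := \matrix_(i, j) M i j; pose NN := \matrix_(i, j) N i j.
suff /mulmx1_min_rank : 1%:M *m MM *m NN = 1%:M.
  by move=> /leq_trans; apply; apply: rank_leq_col.
rewrite mul1mx; apply/matrixP => i l.
have -> : (MM *m NN) i l = \sum_j M i j * N j l.
  by rewrite mxE; apply: eq_bigr => j _; rewrite !mxE.
suff /bfree/(_ l) : U (\sum_l ((i == l)%:R - \sum_j M i j * N j l) *: b l).
  by move=> /eqP; rewrite subr_eq0 mxE => /eqP.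
have -> : \sum_l ((i == l)%:R - \sum_j M i j * N j l) *: b l =
    (b i - \sum_j M i j *: b' j)
    + \sum_j M i j *: (b' j - \sum_l N j l *: b l).
  under [X in _ = _ + X]eq_bigr => j _ do rewrite scalerBr scaler_sumr.
  rewrite sumrB addrA subrK exchange_big /=.
  under eq_bigr => j _ do rewrite scalerBl scaler_suml.
  rewrite sumrB; congr (_ - _).
    rewrite (bigD1 i) //= eqxx scale1r big1 ?addr0 // => j ji.
    by rewrite eq_sym (negPf ji) scale0r.
  by apply: eq_bigr => j _; apply: eq_bigr => m _; rewrite scalerA.
by apply: subspaceD => //; apply: subspace_sum.
Qed.

(** [qtrace] picks a value among all bases and matrices, so each admissible value must be computed:
    any two bases have the same size, and freeness makes every matrix of a map fixing [P] the
    identity. *)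
Lemma qtrace_id (F : fieldType) (V : lmodType F) (P U : set V) (f : V -> V) k
    (b : 'I_k -> V) :
  subspace U -> basis_mod P U b -> (forall p, P p -> f p = p) ->
  qtrace P U f = k%:R.
Proof.
move=> Usub bB fid; apply: xget_unique.
  exists k, b, 1%:M; split=> //; last by rewrite mxtrace1.
  move=> i; rewrite fid; last by case: bB.
  rewrite (bigD1 i) //= mxE eqxx scale1r big1 ?addr0 ?subrr; first by case: Usub.
  by move=> j ji; rewrite mxE eq_sym (negPf ji) scale0r.
move=> _ [k' [b' [M [b'B MP ->]]]].
have -> : k = k'.
  by apply/eqP; rewrite eqn_leq (basis_mod_leq Usub bB b'B) (basis_mod_leq Usub b'B bB).
suff -> : M = 1%:M by rewrite mxtrace1.
have [b'P b'free _] := b'B.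
apply/matrixP => i l; apply/esym.
suff /b'free/(_ l) : U (\sum_l ((i == l)%:R - M i l) *: b' l).
  by move=> /eqP; rewrite subr_eq0 mxE => /eqP.
have := MP i; rewrite fid //; congr (U _).
under [in RHS]eq_bigr => j _ do rewrite scalerBl.
rewrite sumrB; congr (_ - _).
rewrite (bigD1 i) //= eqxx scale1r big1 ?addr0 // => j ji.
by rewrite eq_sym (negPf ji) scale0r.
Qed.

(** A nontrivial relation makes one of [p], [q] proportional to the other modulo [U], which leaves
    dimension 0 or 1. Hence dimension 2 detects exactly the absence of relations. *)
Lemma basis_mod_span2 (F : fieldType) (V : lmodType F) (P U : set V) (p q : V) :
  subspace U -> (forall x, P x <-> exists a b : F, x = a *: p + b *: q) ->
  exists k (c : 'I_k -> V), basis_mod P U c /\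
    (k = 2%N <-> forall a b : F, U (a *: p + b *: q) -> a = 0 /\ b = 0).
Proof.
move=> Usub PE.
have Pp : P p by apply/PE; exists 1, 0; rewrite scale1r scale0r addr0.
have Pq : P q by apply/PE; exists 0, 1; rewrite scale1r scale0r add0r.
(* Modulo [U], [P] is spanned by any [v] to which [p] and [q] are
   proportional. *)
have low v s t : P v -> U (p - s *: v) -> U (q - t *: v) ->
    exists k (c : 'I_k -> V), basis_mod P U c /\ (k < 2)%N.
  move=> Pv pv qv; have [Uv|nUv] := pselect (U v).
    exists 0%N, (fun=> 0); split=> //; split=> [[]//|? _ []//|x /PE[a [b ->]]].
    exists (fun=> 0); rewrite big_ord0 subr0.
    apply: subspaceD => //; apply: subspaceZ => //.
      by rewrite -(subrK (s *: v) p); apply: subspaceD => //; apply: subspaceZ.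
    by rewrite -(subrK (t *: v) q); apply: subspaceD => //; apply: subspaceZ.
  exists 1%N, (fun=> v); split=> //; split=> [//|a|x /PE[a [b ->]]].
    rewrite big_ord_recl big_ord0 addr0 => Uav i; rewrite ord1.
    have [//|a0] := eqVneq (a ord0) 0; case: nUv.
    by rewrite -[v](scalerK a0); apply: subspaceZ.
  exists (fun=> a * s + b * t); rewrite big_ord_recl big_ord0 addr0.
  have -> : a *: p + b *: q - (a * s + b * t) *: v =
      a *: (p - s *: v) + b *: (q - t *: v).
    by rewrite !scalerBr !scalerA scalerDl opprD addrACA.
  by apply: subspaceD => //; apply: subspaceZ.
have [fr|nfr] := pselect (forall a b : F, U (a *: p + b *: q) -> a = 0 /\ b = 0).
  exists 2%N, (fun i : 'I_2 => if i == 0 then p else q); split; last by [].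
  split=> [i|a|x /PE[a [b ->]]]; first by case: ifP.
    rewrite !big_ord_recl big_ord0 addr0 /= => /fr[a0 a1] i.
    case: i => [[|[|//]]] i; first by rewrite -[RHS]a0; congr a; apply: val_inj.
    by rewrite -[RHS]a1; congr a; apply: val_inj.
  exists (fun i : 'I_2 => if i == 0 then a else b).
  by rewrite !big_ord_recl big_ord0 addr0 /= subrr; case: Usub.
suff [k [c [cB k2]]] : exists k (c : 'I_k -> V), basis_mod P U c /\ (k < 2)%N.
  by exists k, c; split=> //; split=> [k_eq|/nfr//]; rewrite k_eq in k2.
have [a [b [Uab]]] : exists a b, U (a *: p + b *: q) /\ ~ (a = 0 /\ b = 0).
  apply: contrapT => h; apply: nfr => a b Uab; apply: contrapT => nab.
  by apply: h; exists a, b.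
(* If [a != 0], then [p] is congruent to [- (a^-1 * b) *: q]; otherwise [b != 0] and the roles of
   [p] and [q] are exchanged. *)
have [->|a0 _] := eqVneq a 0; last first.
  apply: (low q (- (a^-1 * b)) 1) => //; last first.
    by rewrite scale1r subrr; case: Usub.
  rewrite scaleNr opprK -scalerA -{1}[p](scalerK a0) -scalerDr.
  exact: subspaceZ.
move=> nb; have b0 : b != 0 by apply/eqP => b0; apply: nb.
apply: (low p 1 (- (b^-1 * a))) => //; first by rewrite scale1r subrr; case: Usub.
rewrite scaleNr opprK -scalerA -{1}[q](scalerK b0) -scalerDr addrC.
exact: subspaceZ.
Qed.

(** * Characters of symmetric groups of degree at most 1 *)

Lemma perm_eq1 n (s : 'S_n) : (n <= 1)%N -> s = 1%g.
Proof.
move=> n1; apply/permP => i; apply: val_inj; rewrite perm1 /=.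
by case: n n1 s i => [|[|//]] _ s; [case | move=> i; rewrite !ord1].
Qed.

Lemma partn_eq n (l l' : partn n) : (n <= 1)%N -> l = l'.
Proof.
move=> n1; apply: val_inj; case: n n1 l l' => [|[|//]] _ [t tP] [t' t'P] /=.
  by rewrite [t]tuple0 [t']tuple0.
apply: val_inj => /=.
case/tupleP: t tP => i t; rewrite tuple0 /is_partn /= addn0 => /eqP iP.
case/tupleP: t' t'P => j t'; rewrite tuple0 /is_partn /= addn0 => /eqP jP.
by congr [:: _]; apply: val_inj => /=; rewrite iP jP.
Qed.

Lemma shift_perm1 off n j : shift_perm off (1%g : 'S_n) j = j.
Proof.
rewrite /shift_perm; case: leqP => // offj.
by case: insubP => //= i _ iE; rewrite perm1 iE subnKC.
Qed.

(** The group is trivial, so the Young symmetrizer is the unit of the group algebra and the Specht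
    module is the whole group algebra, of dimension 1 with trivial action. *)
Lemma chi_le1 (F : fieldType) n (l : partn n) (s : 'S_n) :
  (n <= 1)%N -> chi F l s = 1.
Proof.
move=> n1; have all1 (t : 'S_n) : t = 1%g by apply: perm_eq1.
have sum1 (A : {set 'S_n}) (f : 'S_n -> F) : 1%g \in A -> \sum_(r in A) f r = f 1%g.
  move=> A1; rewrite (big_pred1 1%g) // => r.
  by rewrite [r]all1 A1 /= eqxx.
have ysE : young_symmetrizer F l = [ffun=> 1].
  apply/ffunP => t; rewrite !ffunE !sum1; last 2 first.
  - by rewrite inE; apply/forallP => i; rewrite perm1.
  - by rewrite inE; apply/forallP => i; rewrite perm1.
  by rewrite odd_perm1 expr0 mul1r [t]all1 mulg1 eqxx.
have sum_all (f : 'S_n -> F) : \sum_t f t = f 1%g.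
  by rewrite (big_pred1 1%g) // => r; rewrite [r]all1 /= eqxx.
have convE (a : group_algebra F n) : convol a (young_symmetrizer F l) = a.
  apply/ffunP => t; rewrite ffunE sum_all ysE ffunE mulr1 [t]all1 //.
rewrite /chi (@qtrace_id _ _ _ _ _ 1 (fun=> [ffun=> 1])) //.
- by split=> // c x y -> ->; rewrite scaler0 addr0.
- split=> [_|a|x _]; first by exists [ffun=> 1]; rewrite convE.
    rewrite big_ord_recl big_ord0 addr0 => /ffunP/(_ 1%g).
    by rewrite !ffunE /= => a0 i; rewrite ord1 -[RHS]a0 /GRing.scale /= mulr1.
  exists (fun=> x 1%g); rewrite big_ord_recl big_ord0 addr0 /=.
  by apply/ffunP => t; rewrite !ffunE [t]all1 /GRing.scale /= mulr1 subrr.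
by move=> x _; apply/ffunP => t; rewrite ffunE [(s^-1 * t)%g]all1 [t]all1.
Qed.

(** * Evaluations of free polynomials, and multiplicities as dimensions *)

Lemma prod_var (F : fieldType) (s : seq variable) :
  \prod_(x <- s) var F x = mkmalgU (FMonom s) 1.
Proof.
elim: s => [|x s IHs].
  by rewrite big_nil; apply: (congr1 (mkmalgU^~ 1)); apply: val_inj; rewrite /= fm1.
rewrite big_cons IHs /var malgM_def fgmulUU mulr1; congr mkmalgU.
by apply: val_inj => /=; rewrite fmM fmuE.
Qed.

Lemma evalE (F : fieldType) (B : lalgType F) (phi : variable -> B)
    (f : free_algebra F) :
  eval phi f = \sum_(m <- finmap.enum_fset (msupp f))
    mcoeff m f *: \prod_(x <- fmonom_val m) phi x.
Proof. by rewrite /eval mmapE; apply: eq_bigr => m _; rewrite mulr_algl. Qed.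

Lemma eval_linear (F : fieldType) (B : lalgType F) (phi : variable -> B) :
  linear (eval phi).
Proof.
move=> c f g; rewrite /eval mmapD; congr (_ + _).
rewrite (mmapEw (msuppZ_le c f)) mmapE scaler_sumr; apply: eq_bigr => m _.
by rewrite mcoeffZ !mulr_algl scalerA.
Qed.

Lemma eval_word (F : fieldType) (B : lalgType F) (phi : variable -> B)
    (s : seq variable) :
  eval phi (\prod_(x <- s) var F x) = \prod_(x <- s) phi x.
Proof. by rewrite prod_var /eval mmapU mulr_algl scale1r. Qed.

(** Permutations act by evaluation at renamed variables; this is the action of the identity. *)
Lemma eval_var (F : fieldType) (f : free_algebra F) : eval (var F) f = f.
Proof.
rewrite evalE [RHS]monalgE; apply: eq_bigr => -[s] _ /=.
by rewrite prod_var -mul_malgC malgM_def fgmulUU mulr1 mul1m.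
Qed.

Lemma Id_subspace (F : fieldType) (A : starAlgebra F) : subspace (Id A).
Proof.
split=> [phi _|c f g fA gA phi phiP]; first by rewrite /eval mmap0.
by rewrite eval_linear fA // gA // scaler0 addr0.
Qed.

(** All four groups are trivial and there is a single multipartition, so the defining equation of
    the cocharacter reads [k%:R = m%:R] in [F]. Characteristic zero recovers [k = m]. *)
Lemma multiplicity_basis (F : fieldType) (A : starAlgebra F) n1 n2 n3 n4
    (l1 : partn n1) (l2 : partn n2) (l3 : partn n3) (l4 : partn n4) k
    (b : 'I_k -> free_algebra F) :
  [pchar F] =i pred0 -> [&& n1 <= 1, n2 <= 1, n3 <= 1 & n4 <= 1]%N ->
  basis_mod (Gamma n1 n2 n3 n4) (Id A) b -> multiplicity A l1 l2 l3 l4 = k.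
Proof.
move=> /pcharf0P F0 /and4P[le1 le2 le3 le4] bB.
have GcharE s1 s2 s3 s4 : @Gamma_char F A n1 n2 n3 n4 s1 s2 s3 s4 = k%:R.
  rewrite /Gamma_char (qtrace_id (Id_subspace A) bB) // => p _.
  rewrite -[RHS](eval_var p); congr (eval _ p); apply/funext => x; congr var.
  rewrite /rename_var (perm_eq1 s1) // (perm_eq1 s2) // (perm_eq1 s3) //.
  by rewrite (perm_eq1 s4) // !shift_perm1; case: x => [[[] []] j].
have sumE (m : {ffun _ -> nat}) s1 s2 s3 s4 :
    \sum_l (m l)%:R * (chi F l.1.1.1 s1 * chi F l.1.1.2 s2
                       * chi F l.1.2 s3 * chi F l.2 s4)
    = (m (l1, l2, l3, l4))%:R.
  rewrite (big_pred1 (l1, l2, l3, l4)) => [|[[[l1' l2'] l3'] l4']] /=.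
    by rewrite !chi_le1 // !mulr1.
  rewrite (partn_eq l1' l1) // (partn_eq l2' l2) // (partn_eq l3' l3) //.
  by rewrite (partn_eq l4' l4) // eqxx.
have inj (i j : nat) : (i <= j)%N -> i%:R = j%:R :> F -> i = j.
  move=> ij /eqP; rewrite eq_sym -subr_eq0 -natrB // F0 subn_eq0 => ji.
  by apply/eqP; rewrite eqn_leq ij ji.
rewrite /multiplicity /proper_cocharacter; case: xgetP => [m _ mP|nP].
  have := mP 1%g 1%g 1%g 1%g; rewrite sumE GcharE => mk.
  by case/orP: (leq_total k (m (l1, l2, l3, l4))) => /inj; [move->|move=> ->].
(* The constant function [k] is a solution, so the default value of [xget] is never reached. *)
case: (nP [ffun=> k]) => s1 s2 s3 s4.
by rewrite sumE GcharE ffunE.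
Qed.

(** * Proper multilinear polynomials in two variables *)

Lemma lspan_subspace (F : fieldType) (V : lmodType F) (S : set V) :
  subspace (lspan S).
Proof.
split.
  by exists 0%N, (fun=> 0), (fun=> 0); rewrite big_ord0; split=> // -[].
move=> c _ _ [k [a [v [vS ->]]]] [k' [a' [v' [v'S ->]]]].
exists (k + k')%N.
exists (fun i => match split i with inl j => c * a j | inr j => a' j end).
exists (fun i => match split i with inl j => v j | inr j => v' j end).
split=> [i|]; first by case: split.
rewrite big_split_ord scaler_sumr /=; congr (_ + _); apply: eq_bigr => i _.
  by rewrite (unsplitK (inl i)) scalerA.
by rewrite (unsplitK (inr i)).
Qed.

Lemma lspan_gen (F : fieldType) (V : lmodType F) (S : set V) p :
  S p -> lspan S p.
Proof.
move=> Sp; exists 1%N, (fun=> 1), (fun=> p); split=> //.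
by rewrite big_ord_recl big_ord0 addr0 scale1r.
Qed.

Lemma perm_eq_pair (T : eqType) (s : seq T) x y :
  perm_eq s [:: x; y] -> s = [:: x; y] \/ s = [:: y; x].
Proof.
move=> sP; have := perm_size sP; case: s sP => [|a [|b []]] //= sP _.
have : a \in [:: x; y] by rewrite -(perm_mem sP) inE eqxx.
rewrite !inE => /orP[/eqP aE|/eqP aE]; rewrite {a}aE in sP *.
  by left; move: sP; rewrite perm_cons => /(perm_small_eq (isT : size [:: _] <= 1)%N)[->].
right; move: sP; rewrite perm_sym (perm_catC [:: x] [:: y]) /= perm_cons perm_sym.
by move=> /(perm_small_eq (isT : size [:: _] <= 1)%N)[->].
Qed.

(** Once [xy] is proper, so is [yx], being [xy] minus the commutator of [x] and [y]. Properness then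
    imposes no condition on multilinear polynomials in [x] and [y]. *)
Lemma Gamma_pair (F : fieldType) n1 n2 n3 n4 (x y : variable) :
  Gamma_vars n1 n2 n3 n4 = [:: x; y] -> proper (var F x * var F y) ->
  forall p, @Gamma F n1 n2 n3 n4 p <->
    exists a b : F, p = a *: (var F x * var F y) + b *: (var F y * var F x).
Proof.
move=> vE xyP.
have yxP : proper (var F y * var F x).
  have -> : var F y * var F x =
      var F x * var F y - (var F x * var F y - var F y * var F x).
    by rewrite subKr.
  apply: subspaceB => //; first exact: lspan_subspace.
  apply: lspan_gen; exists [::], [::], [::], [:: [:: x; y]]; split=> //.
  rewrite !big_nil big_cons big_nil -[LHS]/(lcommutator F [:: x; y]).
  by rewrite (mul1r 1) (mul1r 1) (mulr1 (lcommutator F _)) (mul1r (lcommutator F _)).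
have sub := @lspan_subspace F (free_algebra F).
rewrite /Gamma vE => p; split=> [[[k [a [v [vS ->]]]] _]|[a [b ->]]].
  have vE' i : exists c, v i = c.1 *: (var F x * var F y) + c.2 *: (var F y * var F x).
    have [s /perm_eq_pair[]-> ->] := vS i.
      by exists (1, 0); rewrite /= scale1r scale0r addr0 !big_cons big_nil mulr1.
    by exists (0, 1); rewrite /= scale1r scale0r add0r !big_cons big_nil mulr1.
  have [c cE] := choice vE'.
  exists (\sum_i a i * (c i).1), (\sum_i a i * (c i).2).
  rewrite !scaler_suml -big_split; apply: eq_bigr => i _ /=.
  by rewrite -!scalerA -scalerDr -cE.
have comb S : lspan S (var F x * var F y) -> lspan S (var F y * var F x) ->
    lspan S (a *: (var F x * var F y) + b *: (var F y * var F x)).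
  by move=> Sxy Syx; apply: (sub S).2 => //; apply: subspaceZ (sub S) _ _ Syx.
split; last exact: comb xyP yxP.
apply: comb; apply: lspan_gen.
  by exists [:: x; y] => //; rewrite !big_cons big_nil mulr1.
exists [:: y; x]; first by rewrite (perm_catC [:: y] [:: x]).
by rewrite !big_cons big_nil mulr1.
Qed.

Lemma multiplicity_pair (F : fieldType) (A : starAlgebra F) n1 n2 n3 n4
    (l1 : partn n1) (l2 : partn n2) (l3 : partn n3) (l4 : partn n4)
    (x y : variable) :
  [pchar F] =i pred0 -> [&& n1 <= 1, n2 <= 1, n3 <= 1 & n4 <= 1]%N ->
  Gamma_vars n1 n2 n3 n4 = [:: x; y] -> proper (var F x * var F y) ->
  multiplicity A l1 l2 l3 l4 = 2%N <->
  forall a b : F, Id A (a *: (var F x * var F y) + b *: (var F y * var F x)) ->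
    a = 0 /\ b = 0.
Proof.
move=> F0 le1 vE xyP.
have [k [c [cB k2]]] := basis_mod_span2 (Id_subspace A) (Gamma_pair vE xyP).
by rewrite (multiplicity_basis l1 l2 l3 l4 F0 le1 cB).
Qed.

(** * Polynomials over an algebra, evaluated at scalars *)

Lemma horner_alg_scalar (F : fieldType) (A : algType F) (p : {poly A}) (s : F) :
  p.[s%:A] = \sum_(i < size p) s ^+ i *: p`_i.
Proof.
rewrite horner_coef; apply: eq_bigr => i _.
by rewrite -in_algE -rmorphXn /= mulr_algr.
Qed.

(** Scalars are central, so evaluation at them is multiplicative although [A] need not be
    commutative. *)
Lemma horner_alg_scalarM (F : fieldType) (A : algType F) (p q : {poly A})
    (s : F) : (p * q).[s%:A] = p.[s%:A] * q.[s%:A].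
Proof. by apply: hornerM_comm; rewrite /comm_poly mulr_algl mulr_algr. Qed.

(** In characteristic zero the nodes [0, ..., size p - 1] are distinct in [F], so their Vandermonde
    matrix is invertible over [F] and expresses each coefficient through the values at the nodes. *)
Lemma poly_eq0_horner (F : fieldType) (A : algType F) (p : {poly A}) :
  [pchar F] =i pred0 -> (forall s : F, p.[s%:A] = 0) -> p = 0.
Proof.
move=> /pcharf0P F0 p0; apply/polyP => k; rewrite coef0.
have [|ltk] := leqP (size p) k; first exact: nth_default.
pose V := Vandermonde (size p) (\row_(j < size p) (j%:R : F)).
have Vunit : V \in unitmx.
  rewrite unitmxE unitfE det_Vandermonde; apply/prodf_neq0 => i _.
  apply/prodf_neq0 => j ij; rewrite !mxE -natrB ?F0 ?subn_eq0 -?ltnNge //.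
  exact: ltnW.
(* Inserting [V *m invmx V = 1] and exchanging the sums turns the coefficient into a combination of
   the values of [p] at the nodes. *)
have <- : \sum_(i < size p) (V *m invmx V) i (Ordinal ltk) *: p`_i = p`_k.
  rewrite mulmxV // (bigD1 (Ordinal ltk)) //= mxE eqxx scale1r big1 ?addr0 //.
  by move=> i ik; rewrite mxE (negPf ik) scale0r.
under eq_bigr => i _ do rewrite mxE scaler_suml.
rewrite exchange_big big1 //= => j _.
have := p0 j%:R; rewrite horner_alg_scalar => pj0.
transitivity (invmx V j (Ordinal ltk) *: \sum_(i < size p) j%:R ^+ i *: p`_i).
  by rewrite scaler_sumr; apply: eq_bigr => i _; rewrite !mxE scalerA mulrC.
by rewrite pj0 scaler0.
Qed.

(** * Symmetric and skew homogeneous elements *)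

Lemma star0 (F : fieldType) (A : starAlgebra F) : star (0 : A) = 0.
Proof.
have [stL _ _ _] := star_superinvolution A.
by have := stL (-1) 0 0; rewrite !scaleN1r oppr0 addr0 addNr.
Qed.

Lemma signed_part_subspace (F : fieldType) (A : starAlgebra F) i s :
  subspace (@signed_part F A i s).
Proof.
have [grS _ _ _] := grade_superalgebra A.
have [stL _ _ _] := star_superinvolution A.
split; first by split; [case: (grS i) | rewrite star0 mulr0].
move=> c x y [xi xs] [yi ys]; split; first by apply: (grS i).2.
by rewrite stL xs ys mulrDr scalerAr.
Qed.

(** Write [1 = a0 + a1] by degrees. Then [a0 * a1 = a0 - a0 * a0] is both odd and even, hence 0; so
    [a1 = a1 * a1] is also both, hence 0. Symmetry follows by applying the superinvolution to
    [1 * star 1]. *)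
Lemma signed_part1 (F : fieldType) (A : starAlgebra F) :
  signed_part false false (1 : A).
Proof.
have [grS grM grD grI] := grade_superalgebra A.
have [_ stG stK stM] := star_superinvolution A.
have g1 : grade false (1 : A).
  have [a0 [a1 [a0P a1P a01]]] := grD 1.
  have a01_0 : a0 * a1 = 0.
    apply: grI; last exact: (grM _ _ _ _ a0P a1P).
    have -> : a0 * a1 = a0 - a0 * a0.
      by rewrite -{2}[a0]mulr1 [in X in _ = X - _]a01 mulrDr addrAC subrr add0r.
    by apply: subspaceB => //; exact: (grM _ _ _ _ a0P a0P).
  have a1E : a1 = a1 * a1.
    by rewrite -{1}[a1]mul1r [in LHS]a01 mulrDl a01_0 add0r.
  have a1_0 : a1 = 0.
    by apply: grI => //; rewrite a1E; exact: (grM _ _ _ _ a1P a1P).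
  by rewrite a01 a1_0 addr0.
split=> //; rewrite mulr1.
by have := stM _ _ _ _ g1 (stG _ _ g1); rewrite !mul1r !stK mul1r.
Qed.

(* The type (degree, sign) of [x * y + (-1) ^+ e *: (y * x)] when [x] and [y]
   have types [t] and [t']. *)
Definition product_type (t t' : bool * bool) (e : bool) : bool * bool :=
  (t.1 (+) t'.1, (t.1 && t'.1) (+) t.2 (+) t'.2 (+) e).

(** The superinvolution exchanges [x * y] and [y * x], with the same sign for both, coming from the
    degrees and the signs of [x] and [y]. Restoring the order of the two terms costs the further
    factor [(-1) ^+ e]. *)
Lemma signed_part_product (F : fieldType) (A : starAlgebra F) t t' e (x y : A) :
  signed_part t.1 t.2 x -> signed_part t'.1 t'.2 y ->
  signed_part (product_type t t' e).1 (product_type t t' e).2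
    (x * y + (-1) ^+ e *: (y * x)).
Proof.
have [grS grM _ _] := grade_superalgebra A.
have [stL _ _ stM] := star_superinvolution A.
have stD a b : star (a + b) = star a + star b :> A.
  by rewrite -[a in LHS]scale1r stL scale1r.
have stN a : star (- a) = - star a :> A.
  by have := stL (-1) a 0; rewrite star0 !addr0 !scaleN1r.
case: t t' => [i s] [i' s'] /= [xi xs] [yi ys]; split=> /=.
  rewrite addrC; apply: (grS _).2; last exact: grM.
  by rewrite addbC; apply: grM.
rewrite stD; have -> c : star ((-1) ^+ e *: c) = (-1) ^+ e *: star c :> A.
  by rewrite !scaler_sign; case: e => //; rewrite stN.
rewrite (stM _ _ _ _ xi yi) (stM _ _ _ _ yi xi) xs ys !mulr_sign !scaler_sign.
rewrite [i' && i]andbC; case: (i && i'); case: {xs} s; case: {ys} s'; case: e;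
  by rewrite /= ?(mulrN, mulNr, opprK, opprD) // addrC.
Qed.

(* [G2] and [W] with their gradings and superinvolutions are the models with
   [e = true] and [e = false] respectively. *)
Definition two_step_model (F : fieldType) (B : starAlgebra F)
    (t t' : bool * bool) (e : bool) (u v : B) : Prop :=
  [/\ [/\ u * u = 0, v * v = 0, v * u = (-1) ^+ e *: (u * v) & u * v <> 0],
      signed_part t.1 t.2 u, signed_part t'.1 t'.2 v
    & forall r x, signed_part r.1 r.2 x -> exists c : F * F * F * F,
      [/\ x = c.1.1.1%:A + c.1.1.2 *: u + c.1.2 *: v + c.2 *: (u * v),
          r <> (false, false) -> c.1.1.1 = 0, r <> t -> c.1.1.2 = 0,
          r <> t' -> c.1.2 = 0 & r <> product_type t t' e -> c.2 = 0]].

(** * Lifting evaluations in a model to polynomials over an algebra *)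

(** The relations kill every word of length 3 in [u] and [v], and [v * u] is absorbed into [u * v]
    with factor [s]. *)
Lemma two_step_mul (F : fieldType) (B : algType F) (u v : B) (s : F)
    (a b c d a' b' c' d' : F) :
  u * u = 0 -> v * v = 0 -> v * u = s *: (u * v) ->
  (a%:A + b *: u + c *: v + d *: (u * v))
    * (a'%:A + b' *: u + c' *: v + d' *: (u * v)) =
  (a * a')%:A + (a * b' + b * a') *: u + (a * c' + c * a') *: v
    + (a * d' + d * a' + (b * c' + s * (c * b'))) *: (u * v).
Proof.
move=> uu vv vu; set w := u * v.
have uw : u * w = 0 by rewrite mulrA uu mul0r.
have wv : w * v = 0 by rewrite -mulrA vv mulr0.
have vw : v * w = 0 by rewrite mulrA vu -scalerAl wv scaler0.
have wu : w * u = 0 by rewrite -mulrA vu -scalerAr uw scaler0.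
have ww : w * w = 0 by rewrite mulrA wu mul0r.
rewrite !mulrDl !mulrDr -!scalerAl -!scalerAr !mul1r !mulr1 uu uw vw vv wu wv ww.
rewrite -/w vu !scaler0 !addr0 !scalerA !scalerDl !addrA.
rewrite [LHS](ACl (1*2*5*3*7*4*9*6*8)); congr (_ + _ *: _).
by rewrite mulrC mulrA.
Qed.

(* With [y] in degree 2 and [z] in degree 3 the coefficients 2, 3 and 5 only
   collect the terms linear in [y], linear in [z], and bilinear: a two-parameter
   substitution is encoded in one indeterminate. The coefficients [a, ..., d']
   must not depend on [y] and [z]. *)
Definition two_step_lift (F : fieldType) (A B : algType F) (e : bool) (u v : B)
    (P : A -> A -> {poly A}) (x : B) : Prop :=
  exists a b c d d' : F,
    (forall y z, [/\ (P y z)`_0 = a%:A, (P y z)`_1 = 0, (P y z)`_2 = b *: y,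
       (P y z)`_3 = c *: z & (P y z)`_5 = d *: (y * z) + d' *: (z * y)]) /\
    x = a%:A + b *: u + c *: v + (d + (-1) ^+ e * d') *: (u * v).

Lemma eq_two_step_lift (F : fieldType) (A B : algType F) (e : bool) (u v : B)
    (P Q : A -> A -> {poly A}) (x : B) :
  (forall y z, Q y z = P y z) ->
  two_step_lift e u v P x -> two_step_lift e u v Q x.
Proof.
move=> PQ [a [b [c [d [d' [PE xE]]]]]].
by exists a, b, c, d, d'; split=> // y z; rewrite !PQ.
Qed.

Section Lift.
Variables (F : fieldType) (A B : algType F) (e : bool) (u v : B).
Hypotheses (uu : u * u = 0) (vv : v * v = 0).
Hypothesis vu : v * u = (-1) ^+ e *: (u * v).
Local Notation tslift := (@two_step_lift F A B e u v).

Lemma two_step_lift1 : tslift (fun _ _ => 1) 1.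
Proof.
exists 1, 0, 0, 0, 0; split; last by rewrite mulr0 !scale1r !(addr0, scale0r).
by move=> y z; rewrite !coef1 /= !scale0r scale1r addr0.
Qed.

(** Coefficient 1 is required to vanish so that the uncontrolled coefficient 4 cannot reach degree
    5. There remain the splittings 5 = 0 + 5 = 2 + 3 = 3 + 2 = 5 + 0, and 2 + 3 contributes to
    [y * z] while 3 + 2 contributes to [z * y]. *)
Lemma two_step_liftM P Q x y :
  tslift P x -> tslift Q y -> tslift (fun s t => P s t * Q s t) (x * y).
Proof.
move=> [a [b [c [d [d' [PE ->]]]]]] [a2 [b2 [c2 [d2 [d2' [QE ->]]]]]].
exists (a * a2), (a * b2 + b * a2), (a * c2 + c * a2),
  (a * d2 + d * a2 + b * c2), (a * d2' + d' * a2 + c * b2).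
split; last first.
  by rewrite (two_step_mul _ _ _ _ _ _ _ _ uu vv vu); congr (_ + _ *: _); ring.
move=> s t; have [P0 P1 P2 P3 P5] := PE s t; have [Q0 Q1 Q2 Q3 Q5] := QE s t.
rewrite !coefM !big_ord_recl !big_ord0 /= /bump /= !(add1n, subSS, subn0, sub0n).
rewrite P0 P1 P2 P3 P5 Q0 Q1 Q2 Q3 Q5.
rewrite !(mulr0, mul0r, addr0, add0r) !mulr_algl !mulr_algr.
rewrite -!scalerAl -!scalerAr !scalerDr !scalerA !scalerDl.
split=> //.
- by rewrite [b * a2]mulrC.
- by rewrite [c * a2]mulrC.
rewrite [d * a2]mulrC [d' * a2]mulrC [b * c2]mulrC [c * b2]mulrC !addrA.
by rewrite [RHS](ACl (1*4*3*6*2*5)).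
Qed.

(** The scalar acts as [k%:A] because the polynomials form a module over [A]. *)
Lemma two_step_liftD k P Q x y : tslift P x -> tslift Q y ->
  tslift (fun s t => k%:A *: P s t + Q s t) (k *: x + y).
Proof.
move=> [a [b [c [d [d' [PE ->]]]]]] [a2 [b2 [c2 [d2 [d2' [QE ->]]]]]].
exists (k * a + a2), (k * b + b2), (k * c + c2), (k * d + d2), (k * d' + d2').
split=> [s t|]; last first.
  rewrite !scalerDr !scalerA [LHS](AC (4*4) ((1*5)*(2*6)*(3*7)*(4*8))) /= -!scalerDl.
  by congr (_ + _ *: _); ring.
have [P0 P1 P2 P3 P5] := PE s t; have [Q0 Q1 Q2 Q3 Q5] := QE s t.
rewrite !(coefD, coefZ) P0 P1 P2 P3 P5 Q0 Q1 Q2 Q3 Q5.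
rewrite !mulr_algl scaler0 addr0 !scalerDr !scalerA !scalerDl.
by split=> //; rewrite addrACA.
Qed.

End Lift.

(** [Q] is the evaluation of [f] at the polynomials [P x y z], built monomial by monomial and letter
    by letter; at a scalar it specializes to an evaluation of [f] in [A]. *)
Lemma two_step_lift_eval (F : fieldType) (A B : algType F) (e : bool) (u v : B)
    (P : variable -> A -> A -> {poly A}) (phi : variable -> B)
    (f : free_algebra F) :
  u * u = 0 -> v * v = 0 -> v * u = (-1) ^+ e *: (u * v) ->
  (forall x, two_step_lift e u v (P x) (phi x)) ->
  exists Q : A -> A -> {poly A}, two_step_lift e u v Q (eval phi f) /\
    forall y z (s : F), (Q y z).[s%:A] = eval (fun x => (P x y z).[s%:A]) f.
Proof.
move=> uu vv vu PP.
exists (fun y z => \sum_(m <- finmap.enum_fset (msupp f))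
  (mcoeff m f)%:A *: \prod_(x <- fmonom_val m) P x y z); split=> [|y z s].
  rewrite evalE; elim: (finmap.enum_fset _) => [|m r IHr].
    rewrite big_nil; exists 0, 0, 0, 0, 0; split.
      by move=> y z; rewrite big_nil !coef0 !scale0r addr0.
    by rewrite !(mulr0, addr0, scale0r).
  apply: eq_two_step_lift => [y z|]; first by rewrite big_cons.
  rewrite big_cons; apply: two_step_liftD => //.
  elim: (fmonom_val m) => [|x w IHw].
    apply: eq_two_step_lift => [y z|]; first by rewrite big_nil.
    by rewrite big_nil; apply: two_step_lift1.
  apply: eq_two_step_lift => [y z|]; first by rewrite big_cons.
  by rewrite big_cons; apply: two_step_liftM.
rewrite evalE horner_sum; apply: eq_bigr => m _; rewrite hornerZ mulr_algl.
congr (_ *: _); elim: (fmonom_val m) => [|x w IHw].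
  by rewrite !big_nil hornerC.
by rewrite !big_cons horner_alg_scalarM IHw.
Qed.

Lemma in_variety_two_step (F : fieldType) (A B : starAlgebra F) t t' e (u v : B) :
  [pchar F] =i pred0 -> two_step_model t t' e u v ->
  (forall a b : F, (forall y z : A, signed_part t.1 t.2 y ->
     signed_part t'.1 t'.2 z -> a *: (y * z) + b *: (z * y) = 0) ->
     a = 0 /\ b = 0) ->
  in_variety A B.
Proof.
move=> F0 [[uu vv vu _] _ _ dec] indep f fA phi phiP.
have ch2 : 2%:R != 0 :> F by move/pcharf0P: (F0) => ->.
have phiP' x : signed_part x.1.1 x.1.2 (phi x) by case: x => [[i s] j].
have [c cP] := choice (fun x : variable => dec x.1 (phi x) (phiP' x)).
(* The symmetrized product in degree 5 has the same type as [u * v]. It lifts [c.2 *: (u * v)],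
   since its two terms contribute one half each, the sign being squared. *)
pose P (x : variable) (y z : A) : {poly A} := Poly [:: (c x).1.1.1%:A; 0;
  (c x).1.1.2 *: y; (c x).1.2 *: z; 0;
  ((c x).2 / 2%:R) *: (y * z + (-1) ^+ e *: (z * y))].
have PP x : two_step_lift e u v (P x) (phi x).
  exists (c x).1.1.1, (c x).1.1.2, (c x).1.2, ((c x).2 / 2%:R),
    ((-1) ^+ e * ((c x).2 / 2%:R)); split=> [y z|].
    by rewrite !coef_Poly /= scalerDr scalerA [_ * (-1) ^+ e]mulrC.
  have [-> _ _ _ _] := cP x; congr (_ + _ *: _).
  by rewrite mulrA -expr2 sqrr_sign mul1r -mulrDr -[2%:R]/(1 + 1); field.
have [Q [[a [b [b' [d [d' [QE ->]]]]]] Qhorner]] := two_step_lift_eval f uu vv vu PP.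
have Q0 y z : signed_part t.1 t.2 y -> signed_part t'.1 t'.2 z -> Q y z = 0.
  (* At each scalar, all variables take values of their own type in [A], so the identity [f]
     vanishes there. *)
  move=> yt zt; apply: poly_eq0_horner => // s; rewrite Qhorner.
  apply: fA => i j k; rewrite horner_alg_scalar.
  have sub := signed_part_subspace A i j; apply: subspace_sum => // l.
  have [_ a0 b0 b0' d0] := cP ((i, j), k).
  have signedZ (r : bool * bool) (l' : F) (x : A) : signed_part r.1 r.2 x ->
      ((i, j) <> r -> l' = 0) -> signed_part i j (l' *: x).
    move=> xr l0; have [ijr|/eqP/l0->] := eqVneq (i, j) r; last first.
      by rewrite scale0r; case: sub.
    by apply: subspaceZ => //; rewrite -ijr in xr.
  have s0 : signed_part i j (0 : A) by case: sub.
  rewrite coef_Poly; case: l => [[|[|[|[|[|[|l]]]]]] _] //=.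
  - by apply: (signedZ (false, false)) => //; apply: signed_part1.
  - exact: signedZ yt b0.
  - exact: signedZ zt b0'.
  - apply: signedZ (signed_part_product e yt zt) _ => /d0->.
    by rewrite mul0r.
  - by rewrite nth_nil.
have [z1 z2] : signed_part t.1 t.2 (0 : A) /\ signed_part t'.1 t'.2 (0 : A).
  by split; apply: (signed_part_subspace A _ _).1.
(* If a nonzero [k] forced all products [y * z] to vanish, then [1] and [0] would be the
   coefficients of a nontrivial relation. *)
have contra (k : F) : (k != 0 -> forall y z : A, signed_part t.1 t.2 y ->
    signed_part t'.1 t'.2 z -> y * z = 0) -> k = 0.
  move=> yz0; have [//|/yz0 {}yz0] := eqVneq k 0.
  have [|/eqP] := indep 1 0; last by rewrite oner_eq0.
  by move=> y z yt zt; rewrite yz0 // scaler0 scale0r addr0.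
have -> : a = 0.
  have [+ _ _ _ _] := QE 0 0; rewrite Q0 // coef0 => /esym/eqP.
  by rewrite scaler_eq0 oner_eq0 orbF => /eqP.
have -> : b = 0.
  apply: contra => b0 y z yt zt; have [_ _ + _ _] := QE y z.
  rewrite Q0 // coef0 => /esym/eqP; rewrite scaler_eq0 (negPf b0) => /eqP->.
  by rewrite mul0r.
have -> : b' = 0.
  apply: contra => b0 y z yt zt; have [_ _ _ + _] := QE y z.
  rewrite Q0 // coef0 => /esym/eqP; rewrite scaler_eq0 (negPf b0) => /eqP->.
  by rewrite mulr0.
(* Coefficient 5 of [Q y z] is [d *: (y * z) + d' *: (z * y)], with [d] and [d'] independent of [y]
   and [z], so independence applies directly. *)
have [y z yt zt|-> ->] := indep d d'; last by rewrite mulr0 !(addr0, scale0r).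
by have [_ _ _ _ <-] := QE y z; rewrite Q0 // coef0.
Qed.

(** * Direct sums and the criterion for membership in the variety *)

Lemma eval_dsum (F : fieldType) (A B : starAlgebra F)
    (phi : variable -> dsum A B) (f : free_algebra F) :
  eval phi f = (eval (fun x => (phi x).1) f, eval (fun x => (phi x).2) f).
Proof.
have prodE (s : seq variable) : \prod_(x <- s) phi x =
    (\prod_(x <- s) (phi x).1, \prod_(x <- s) (phi x).2).
  by elim: s => [|x s IHs]; rewrite ?big_nil ?big_cons ?IHs.
rewrite !evalE; elim: (finmap.enum_fset _) => [|m r IHr].
  by rewrite !big_nil.
by rewrite !big_cons IHr prodE.
Qed.

Lemma signed_part_dsum (F : fieldType) (A B : starAlgebra F) i s
    (w : dsum A B) :
  signed_part i s w <-> signed_part i s w.1 /\ signed_part i s w.2.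
Proof.
case: w => a b; rewrite /signed_part /= /dsum_star /= !mulr_sign.
split=> [[[ai bi]]|[[ai ea] [bi eb]]]; first by case: s => -[ea eb].
by split=> //; case: s ea eb => ea eb; rewrite ea eb.
Qed.

(** Evaluations are componentwise, and an evaluation in one summand extends by 0 to the other. *)
Lemma in_variety_dsum (F : fieldType) (A B B' : starAlgebra F) :
  in_variety A (dsum B B') <-> in_variety A B /\ in_variety A B'.
Proof.
split=> [AB|[AB AB'] f fA phi phiP]; last first.
  rewrite eval_dsum AB ?AB' // => i s j;
    by have /signed_part_dsum[] := phiP i s j.
split=> f fA phi phiP.
  pose psi x : dsum B B' := (phi x, 0).
  have psiP i s j : signed_part i s (psi (i, s, j)).
    apply/signed_part_dsum; split; first exact: phiP.
    exact: (signed_part_subspace B' i s).1.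
  by have := congr1 fst (AB f fA psi psiP); rewrite eval_dsum.
pose psi x : dsum B B' := (0, phi x).
have psiP i s j : signed_part i s (psi (i, s, j)).
  apply/signed_part_dsum; split; last exact: phiP.
  exact: (signed_part_subspace B i s).1.
by have := congr1 snd (AB f fA psi psiP); rewrite eval_dsum.
Qed.

Lemma eval_pair (F : fieldType) (B : lalgType F) (phi : variable -> B)
    (a b : F) (x y : variable) :
  eval phi (a *: (var F x * var F y) + b *: (var F y * var F x)) =
  a *: (phi x * phi y) + b *: (phi y * phi x).
Proof.
have evalM z w : eval phi (var F z * var F w) = phi z * phi w.
  have := eval_word phi [:: z; w].
  by rewrite !big_cons !big_nil !mulr1.
have eval0 : eval phi 0 = 0 by rewrite evalE msupp0 big_nil.
have evalZ c p : eval phi (c *: p) = c *: eval phi p.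
  by have := eval_linear phi c p 0; rewrite eval0 (addr0 (c *: p)) addr0.
by rewrite -(evalM x y) -(evalM y x) -(evalZ b); apply: eval_linear.
Qed.

(** Substituting the generators of the two models into an identity of [A] gives [a - b = 0] and
    [a + b = 0], whence both vanish in characteristic zero. The converse applies the lifting
    argument to each summand. *)
Lemma indep_dsum (F : fieldType) (A B B' : starAlgebra F) t t' j j'
    (u v : B) (u' v' : B') :
  [pchar F] =i pred0 -> t != t' ->
  two_step_model t t' true u v -> two_step_model t t' false u' v' ->
  (forall a b : F, Id A (a *: (var F (t, j) * var F (t', j'))
                         + b *: (var F (t', j') * var F (t, j))) ->
    a = 0 /\ b = 0) <-> in_variety A (dsum B B').
Proof.
move=> F0 tt' mB mB'; rewrite in_variety_dsum; split=> [indep|[AB AB'] a b abA].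
  have indep' (a b : F) : (forall y z : A, signed_part t.1 t.2 y ->
     signed_part t'.1 t'.2 z -> a *: (y * z) + b *: (z * y) = 0) ->
     a = 0 /\ b = 0.
    move=> ab0; apply: indep => phi phiP; rewrite eval_pair.
    by apply: ab0; [case: t {tt' mB mB'}|case: t' {tt' mB mB'}] => i s; apply: phiP.
  by split; [apply: in_variety_two_step mB _|apply: in_variety_two_step mB' _].
have substitute (C : starAlgebra F) e (w z : C) : two_step_model t t' e w z ->
    in_variety A C -> a + (-1) ^+ e * b = 0.
  move=> [[_ _ zw wz0] wt zt _] AC.
  (* The value depends on the type alone; [t != t'] lets the two variables be sent to [w] and [z]
     independently. *)
  pose phi (x : variable) : C := if x.1 == t then w else if x.1 == t' then z else 0.
  have := AC _ abA phi; rewrite eval_pair /phi /= !eqxx eq_sym (negPf tt') zw.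
  rewrite scalerA -scalerDl [b * _]mulrC => ab0.
  apply/eqP; have /eqP : (a + (-1) ^+ e * b) *: (w * z) = 0.
    apply: ab0 => i s k; have [E|_] := eqVneq (i, s) t; first by rewrite -E in wt.
    have [E|_] := eqVneq (i, s) t'; first by rewrite -E in zt.
    by apply: (signed_part_subspace C i s).1.
  by rewrite scaler_eq0 => /orP[//|/eqP].
have := substitute _ _ _ _ mB AB; have := substitute _ _ _ _ mB' AB'.
rewrite expr0 expr1 mul1r mulN1r => sum0 /eqP; rewrite subr_eq0 => /eqP ab.
have b0 : b = 0.
  move: sum0; rewrite ab -mulr2n -mulr_natr => /eqP.
  by move/pcharf0P: F0 => F0; rewrite mulf_eq0 F0 orbF => /eqP.
by rewrite ab b0.
Qed.

(** * The six concrete algebras as two-step models *)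

Lemma oppr_self_eq0 (F : fieldType) (x : F) :
  [pchar F] =i pred0 -> - x = x -> x = 0.
Proof.
move=> /pcharf0P F0 /eqP; rewrite eq_sym -addr_eq0 -mulr2n -mulr_natr mulf_eq0.
by rewrite F0 orbF => /eqP.
Qed.

Lemma G2_sign (F : fieldType) (s : bool) (x : G2 F) k :
  ((-1) ^+ s * x) 0 k = (-1) ^+ s * x 0 k.
Proof. by rewrite !mulr_sign; case: s; rewrite ?mxE. Qed.

Lemma G2_dec (F : fieldType) (x : G2 F) :
  x = (x 0 0)%:A + x 0 1 *: e1 F + x 0 2%:R *: e2 F + x 0 3%:R *: (e1 F * e2 F).
Proof. by have [_ _ _ <-] := G2_relations F; apply: G2eta. Qed.

Lemma e1e2_neq0 (F : fieldType) : e1 F * e2 F <> 0.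
Proof.
rewrite G2mulE => /rowP/(_ 3%:R); rewrite G2E mxE !(mul0r, mulr0, mulr1, add0r, subr0).
by move/eqP; rewrite oner_eq0.
Qed.

Lemma G2_gamma_gri_model (F : fieldType) : [pchar F] =i pred0 ->
  @two_step_model F (G2_gamma_gri F) (false, true) (true, false) true (e1 F) (e2 F).
Proof.
move=> F0; have [r1 r2 r12 _] := G2_relations F.
split; first by split=> //; [rewrite scaleN1r r12 opprK | apply: e1e2_neq0].
- split; first by apply/G2_griE; rewrite !G2E.
  by apply: G2P; rewrite G2_sign /= /gamma_gri !G2E; ring.
- split; first by apply/G2_griE; rewrite !G2E.
  by apply: G2P; rewrite G2_sign /= /gamma_gri !G2E; ring.
move=> [i s] x [/= /G2_griE xi xs]; exists (x 0 0, x 0 1, x 0 2%:R, x 0 3%:R) => /=.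
have e k : gamma_gri x 0 k = (-1) ^+ s * x 0 k by rewrite xs G2_sign.
move: (e 0) (e 1) (e 2%:R) (e 3%:R); rewrite /gamma_gri !G2E => x0 x1 x2 x3.
split; first by apply: G2_dec.
(* For each type, a coordinate is excluded by its degree or by its sign under the superinvolution,
   unless the type is the one allowed for it. *)
all: by case: i s xi x0 x1 x2 x3 {xs e} => [] [] /=;
  rewrite ?mulN1r ?mul1r ?oppr_eq0 => -[? ?] x0 x1 x2 x3;
  first [by move=> /(_ erefl) | move=> _; first [done
    | exact: oppr_self_eq0 | apply: oppr_self_eq0 F0 _; exact: esym]].
Qed.

Lemma G2_gamma_gr_model (F : fieldType) : [pchar F] =i pred0 ->
  @two_step_model F (G2_gamma_gr F) (true, false) (true, true) true (e2 F) (e1 F).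
Proof.
move=> F0; have [r1 r2 r12 _] := G2_relations F.
split; first by split=> //;
  [rewrite scaleN1r | apply/eqP; rewrite -oppr_eq0 -r12; apply/eqP/e1e2_neq0].
- split; first by apply/G2_grE; rewrite !G2E.
  by apply: G2P; rewrite G2_sign /= /gamma_gr !G2E; ring.
- split; first by apply/G2_grE; rewrite !G2E.
  by apply: G2P; rewrite G2_sign /= /gamma_gr !G2E; ring.
(* Here [u = e2] is the symmetric generator and [v = e1] the skew one, so [u * v = - (e1 * e2)] and
   the last coordinate changes sign. *)
move=> [i s] x [/= /G2_grE xi xs]; exists (x 0 0, x 0 2%:R, x 0 1, - x 0 3%:R) => /=.
have e k : gamma_gr x 0 k = (-1) ^+ s * x 0 k by rewrite xs G2_sign.
move: (e 0) (e 1) (e 2%:R) (e 3%:R); rewrite /gamma_gr !G2E => x0 x1 x2 x3.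
split; first by rewrite scaleNr -scalerN -r12 {1}[x]G2_dec [_ + x 0 2%:R *: _]addrAC.
all: by case: i s xi x0 x1 x2 x3 {xs e} => [] [] /=;
  rewrite ?mulN1r ?mul1r ?oppr_eq0 => -[? ?] x0 x1 x2 x3;
  first [by move=> /(_ erefl)
    | move=> _; apply/eqP; rewrite ?oppr_eq0; apply/eqP; first [done
    | exact: oppr_self_eq0 | apply: oppr_self_eq0 F0 _; exact: esym]].
Qed.

Lemma G2_tau_gri_model (F : fieldType) : [pchar F] =i pred0 ->
  @two_step_model F (G2_tau_gri F) (false, true) (true, true) true (e1 F) (e2 F).
Proof.
move=> F0; have [r1 r2 r12 _] := G2_relations F.
split; first by split=> //; [rewrite scaleN1r r12 opprK | apply: e1e2_neq0].
- split; first by apply/G2_griE; rewrite !G2E.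
  by apply: G2P; rewrite G2_sign /= /tau_gri !G2E; ring.
- split; first by apply/G2_griE; rewrite !G2E.
  by apply: G2P; rewrite G2_sign /= /tau_gri !G2E; ring.
move=> [i s] x [/= /G2_griE xi xs]; exists (x 0 0, x 0 1, x 0 2%:R, x 0 3%:R) => /=.
have e k : tau_gri x 0 k = (-1) ^+ s * x 0 k by rewrite xs G2_sign.
move: (e 0) (e 1) (e 2%:R) (e 3%:R); rewrite /tau_gri !G2E => x0 x1 x2 x3.
split; first by apply: G2_dec.
all: by case: i s xi x0 x1 x2 x3 {xs e} => [] [] /=;
  rewrite ?mulN1r ?mul1r ?oppr_eq0 => -[? ?] x0 x1 x2 x3;
  first [by move=> /(_ erefl) | move=> _; first [done
    | exact: oppr_self_eq0 | apply: oppr_self_eq0 F0 _; exact: esym]].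
Qed.

Lemma W_dec (F : fieldType) (a b c d : F) :
  Welt a b c d = a%:A + b *: Welt 0 1 0 0 + c *: Welt 0 0 1 0
    + d *: (Welt 0 1 0 0 * Welt 0 0 1 0).
Proof.
have W1 : Welt 1 0 0 0 = 1 :> W F by apply: val_inj; apply: Wmx1.
rewrite Welt_mul -W1 -[a *: _]addr0 -Welt0 Welt_lin.
rewrite [_ + b *: _]addrC [_ + c *: _]addrC [_ + d *: _]addrC !Welt_lin.
by congr Welt; ring.
Qed.

Lemma mulWC (F : fieldType) (x y : W F) : x * y = y * x.
Proof.
elim/W_ind: x => a b c d; elim/W_ind: y => a' b' c' d'.
by rewrite !Welt_mul; congr Welt; ring.
Qed.

Lemma W_eta1_gri_model (F : fieldType) : [pchar F] =i pred0 ->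
  @two_step_model F (W_eta1_gri F) (false, true) (true, false) false
    (Welt 0 1 0 0) (Welt 0 0 1 0).
Proof.
move=> F0; split.
- split; [| | |rewrite Welt_mul -Welt0 => /Welt_inj[_ _ _]/eqP];
    rewrite ?scale1r ?Welt_mul ?mul0r ?mulr0 ?addr0 ?add0r ?mulr1 ?Welt0 //.
  by rewrite oner_eq0.
- split; first by do 2!eexists.
  by rewrite Welt_sign /= /eta1 W_mapE; congr Welt; ring.
- split; first by do 2!eexists.
  by rewrite Welt_sign /= /eta1 W_mapE; congr Welt; ring.
move=> [i s]; elim/W_ind=> a b c d [/= xi].
rewrite Welt_sign /eta1 W_mapE => /Welt_inj[ea eb ec ed]; exists (a, b, c, d) => /=.
split; first by apply: W_dec.
all: by case: i s xi ea eb ec ed => [] [] [? [? /Welt_inj[? ? ? ?]]];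
  rewrite ?mulN1r ?mul1r => ea eb ec ed;
  first [by move=> /(_ erefl) | move=> _; first [done
    | exact: oppr_self_eq0 | apply: oppr_self_eq0 F0 _; exact: esym]].
Qed.

Lemma W_eta2_gr_model (F : fieldType) : [pchar F] =i pred0 ->
  @two_step_model F (W_eta2_gr F) (true, false) (true, true) false
    (Welt 0 0 1 0) (Welt 0 1 0 0).
Proof.
move=> F0; split.
- split; [| | |rewrite Welt_mul -Welt0 => /Welt_inj[_ _ _]/eqP];
    rewrite ?scale1r ?Welt_mul ?mul0r ?mulr0 ?addr0 ?add0r ?mulr1 ?Welt0 //.
  by rewrite oner_eq0.
- split; first by do 2!eexists.
  by rewrite Welt_sign /= /eta2 W_mapE; congr Welt; ring.
- split; first by do 2!eexists.
  by rewrite Welt_sign /= /eta2 W_mapE; congr Welt; ring.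
move=> [i s]; elim/W_ind=> a b c d [/= xi].
(* The symmetric generator [u] carries the coordinate [c] and the skew one [v] carries [b], hence
   the exchange; [W] is commutative, so [d] is unaffected. *)
rewrite Welt_sign /eta2 W_mapE => /Welt_inj[ea eb ec ed]; exists (a, c, b, d) => /=.
split; first by apply: etrans (W_dec a b c d) _;
  rewrite [a%:A + _ + _]addrAC (mulWC (Welt 0 1 0 0)).
all: by case: i s xi ea eb ec ed => [] [] [? [? /Welt_inj[? ? ? ?]]];
  rewrite ?mulN1r ?mul1r => ea eb ec ed;
  first [by move=> /(_ erefl) | move=> _; first [done
    | exact: oppr_self_eq0 | apply: oppr_self_eq0 F0 _; exact: esym]].
Qed.

Lemma W_eta3_gri_model (F : fieldType) : [pchar F] =i pred0 ->
  @two_step_model F (W_eta3_gri F) (false, true) (true, true) false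
    (Welt 0 1 0 0) (Welt 0 0 1 0).
Proof.
move=> F0; split.
- split; [| | |rewrite Welt_mul -Welt0 => /Welt_inj[_ _ _]/eqP];
    rewrite ?scale1r ?Welt_mul ?mul0r ?mulr0 ?addr0 ?add0r ?mulr1 ?Welt0 //.
  by rewrite oner_eq0.
- split; first by do 2!eexists.
  by rewrite Welt_sign /= /eta3 W_mapE; congr Welt; ring.
- split; first by do 2!eexists.
  by rewrite Welt_sign /= /eta3 W_mapE; congr Welt; ring.
move=> [i s]; elim/W_ind=> a b c d [/= xi].
rewrite Welt_sign /eta3 W_mapE => /Welt_inj[ea eb ec ed]; exists (a, b, c, d) => /=.
split; first by apply: W_dec.
all: by case: i s xi ea eb ec ed => [] [] [? [? /Welt_inj[? ? ? ?]]];
  rewrite ?mulN1r ?mul1r => ea eb ec ed;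
  first [by move=> /(_ erefl) | move=> _; first [done
    | exact: oppr_self_eq0 | apply: oppr_self_eq0 F0 _; exact: esym]].
Qed.

(** * Assembling the three equivalences *)

(** Without symmetric variables of degree 0, a product in the prescribed order of types is proper
    with an empty list of commutators. *)
Lemma proper_pair (F : fieldType) (s1 s2 s3 : seq nat) (x y : variable) :
  [seq ((false, true), j) | j <- s1] ++ [seq ((true, false), j) | j <- s2]
    ++ [seq ((true, true), j) | j <- s3] = [:: x; y] ->
  proper (var F x * var F y).
Proof.
move=> xyE; apply: lspan_gen; exists s1, s2, s3, [::]; split; first by [].
apply: (@etrans _ _ (\prod_(z <- [:: x; y]) var F z)).
  by rewrite !big_cons big_nil (mulr1 (var F y)).
rewrite -xyE !big_cat !big_map big_nil /= mulrA.
exact: esym (mulr1 _).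
Qed.

Local Close Scope ring_scope.

Theorem lemma4p6 (R : realType) (F : fieldType) (charF : [pchar F]%R =i pred0)
    (A : starAlgebra F) (A_FJ : type_F_plus_J A)
    (A_growth : quadratic_growth R A) :
  [/\ multiplicity A part_empty part_one part_one part_empty = 2 <->
        in_variety A (dsum (G2_gamma_gri F) (W_eta1_gri F)),
      multiplicity A part_empty part_empty part_one part_one = 2 <->
        in_variety A (dsum (G2_gamma_gr F) (W_eta2_gr F))
    & multiplicity A part_empty part_one part_empty part_one = 2 <->
        in_variety A (dsum (G2_tau_gri F) (W_eta3_gri F))].
Proof.
split.
(* The lists give the indices of the skew even, symmetric odd and skew odd variables; [Gamma_vars]
   numbers the variables consecutively across the types. *)
- apply: (iff_trans (multiplicity_pair A part_empty part_one part_one part_empty charF isT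
    erefl (@proper_pair F [:: 0] [:: 1] [::] _ _ erefl))).
  exact: indep_dsum (G2_gamma_gri_model charF) (W_eta1_gri_model charF).
- apply: (iff_trans (multiplicity_pair A part_empty part_empty part_one part_one charF isT
    erefl (@proper_pair F [::] [:: 0] [:: 1] _ _ erefl))).
  exact: indep_dsum (G2_gamma_gr_model charF) (W_eta2_gr_model charF).
apply: (iff_trans (multiplicity_pair A part_empty part_one part_empty part_one charF isT
    erefl (@proper_pair F [:: 0] [::] [:: 1] _ _ erefl))).
exact: indep_dsum (G2_tau_gri_model charF) (W_eta3_gri_model charF).
Qed.
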